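(* Let $(X,\mathcal{O}_X)$ be a locally coherent scheme and let $\mathscr{F}$ be a quasi-coherent sheaf on $X$. The following conditions are equivalent: 1. $\mathscr{F}(U)$ is an absolutely pure $\mathcal{O}_X(U)$-module for every affine open $U\subseteq X$. 2. There is a cover $\{U_i\}_{i\in I}$ of $X$ by affine open subsets such that $\mathscr{F}(U_i)$ is an absolutely pure $\mathcal{O}_X(U_i)$-module for all $i \in I$. 3. $\mathscr{F}_x$ is an absolutely pure $\mathcal{O}_{X,x}$-module for all $x \in X$.
   Context: A scheme $X$ is locally coherent if $\mathcal{O}_X(U)$ is a coherent ring for each affine open $U\subseteq X$. For a commutative ring $R$, an $R$-module $A$ is absolutely pure if it is a pure submodule of every $R$-module containing it, where a submodule $L\subseteq N$ is pure if $T\otimes_R L\to T\otimes_R N$ is injective for every $R$-module $T$. *)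

(* Defs.v *)
From HB Require Import structures.
From mathcomp Require Import all_boot all_order all_algebra.
From mathcomp Require Import generic_quotient.
From mathcomp Require Import all_classical topology.
From mathcomp Require Import ring.

Set Implicit Arguments.
Unset Strict Implicit.
Unset Printing Implicit Defensive.

Import GRing.Theory.
Local Open Scope classical_set_scope.
Local Open Scope quotient_scope.
Local Open Scope ring_scope.

(* All rings are commutative and possibly zero (comPzRingType): the ring of
   sections over the empty set is the zero ring. *)

Section Ideals.
Variable R : comPzRingType.

Definition ideal (I : set R) : Prop :=
  [/\ I 0, forall a b, I a -> I b -> I (a + b) & forall a b, I b -> I (a * b)].

Definition prime_ideal (p : set R) : Prop :=
  [/\ ideal p, ~ p 1 & forall a b, p (a * b) -> p a \/ p b].

Definition maximal_ideal (m : set R) : Prop :=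
  [/\ ideal m, ~ m 1 & forall I, ideal I -> ~ I 1 -> m `<=` I -> I = m].

Definition local_ring : Prop := exists! m : set R, maximal_ideal m.

End Ideals.

Section Coherent.
Variable R : comPzRingType.

Definition span_of (M : lmodType R) (n : nat) (v : 'I_n -> M) : set M :=
  [set x | exists c : 'I_n -> R, x = \sum_(i < n) c i *: v i].

Definition finitely_generated (M : lmodType R) (N : set M) : Prop :=
  exists (n : nat) (v : 'I_n -> M), N = span_of v.

(* The submodule N of M is the image of a linear map R^n -> M with finitely
   generated kernel. *)
Definition finitely_presented (M : lmodType R) (N : set M) : Prop :=
  exists (n : nat) (f : {linear 'rV[R]_n -> M}),
    range f = N /\ finitely_generated [set x | f x = 0].

Definition coherent_ring : Prop :=
  forall I : set R^o, finitely_generated I -> finitely_presented I.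

End Coherent.

(* The tensor product is the commutative monoid of formal sums of pairs (lists
   up to reordering) modulo bilinearity; it is a group because
   (t, n) + (- t, n) is identified with (0, n), hence with 0. *)
Section Tensor.
Variables (R : comPzRingType) (T N : lmodType R).

Inductive tens_rel : seq (T * N) -> seq (T * N) -> Prop :=
| tens_refl s : tens_rel s s
| tens_sym s t : tens_rel s t -> tens_rel t s
| tens_trans s t u : tens_rel s t -> tens_rel t u -> tens_rel s u
| tens_cat s s' t t' :
    tens_rel s s' -> tens_rel t t' -> tens_rel (s ++ t) (s' ++ t')
| tens_catC s t : tens_rel (s ++ t) (t ++ s)
| tens_0l n : tens_rel [:: (0, n)] [::]
| tens_0r t : tens_rel [:: (t, 0)] [::]
| tens_addl t t' n : tens_rel [:: (t + t', n)] [:: (t, n); (t', n)]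
| tens_addr t n n' : tens_rel [:: (t, n + n')] [:: (t, n); (t, n')]
| tens_scale r t n : tens_rel [:: (r *: t, n)] [:: (t, r *: n)].

Definition tens_eqv : rel (seq (T * N)) := fun s t => `[< tens_rel s t >].

Lemma tens_eqv_class : equiv_class_of tens_eqv.
Proof.
split=> [s|s t|t s u].
- by apply/asboolP; constructor.
- by apply/asboolP/asboolP => h; apply: tens_sym.
- by move=> /asboolP h1 /asboolP h2; apply/asboolP; exact: tens_trans h1 h2.
Qed.

Canonical tens_equiv := EquivRelPack tens_eqv_class.

Definition tensor : Type := {eq_quot tens_equiv}.
HB.instance Definition _ := Choice.on tensor.

Definition tens_sum (s : seq (T * N)) : tensor := \pi_({eq_quot tens_equiv}) s.
Definition tens (t : T) (n : N) : tensor := tens_sum [:: (t, n)].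

Lemma tens_sumP s t : tens_sum s = tens_sum t <-> tens_rel s t.
Proof.
split=> [/eqquotP h|h]; first exact/asboolP.
by apply/eqquotP/asboolP.
Qed.

Lemma tens_sum_ex (a : tensor) : exists s, a = tens_sum s.
Proof. by exists (repr (a : {eq_quot tens_equiv})); rewrite /tens_sum reprK. Qed.

Definition tensor_rep (a : tensor) : seq (T * N) :=
  repr (a : {eq_quot tens_equiv}).

Lemma tensor_repP s : tens_rel (tensor_rep (tens_sum s)) s.
Proof. by apply/tens_sumP; rewrite /tens_sum /tensor_rep reprK. Qed.

Definition tens_neg (x : T * N) : T * N := (- x.1, x.2).

Lemma tens_rel_neg s t : tens_rel s t -> tens_rel (map tens_neg s) (map tens_neg t).
Proof.
elim=> {s t} //=.
- by move=> s; constructor.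
- by move=> s t _; exact: tens_sym.
- by move=> s t u _ h _; exact: tens_trans.
- by move=> s s' t t' _ h _ h'; rewrite !map_cat; exact: tens_cat.
- by move=> s t; rewrite !map_cat; exact: tens_catC.
- by move=> n; rewrite /tens_neg /= oppr0; constructor.
- by move=> t; rewrite /tens_neg /=; constructor.
- by move=> t t' n; rewrite /tens_neg /= opprD; constructor.
- by move=> t n n'; rewrite /tens_neg /=; constructor.
- by move=> r t n; rewrite /tens_neg /= -scalerN; constructor.
Qed.

Definition tensor_add (a b : tensor) := tens_sum (tensor_rep a ++ tensor_rep b).
Definition tensor_opp (a : tensor) := tens_sum (map tens_neg (tensor_rep a)).

Lemma tensor_addE s t : tensor_add (tens_sum s) (tens_sum t) = tens_sum (s ++ t).
Proof. by apply/tens_sumP; apply: tens_cat; exact: tensor_repP. Qed.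

Lemma tensor_oppE s : tensor_opp (tens_sum s) = tens_sum (map tens_neg s).
Proof. by apply/tens_sumP; apply: tens_rel_neg; exact: tensor_repP. Qed.

Lemma tensor_addA : associative tensor_add.
Proof.
move=> a b c; have [s ->] := tens_sum_ex a; have [t ->] := tens_sum_ex b.
by have [u ->] := tens_sum_ex c; rewrite !tensor_addE catA.
Qed.

Lemma tensor_addC : commutative tensor_add.
Proof.
move=> a b; have [s ->] := tens_sum_ex a; have [t ->] := tens_sum_ex b.
by rewrite !tensor_addE; apply/tens_sumP; exact: tens_catC.
Qed.

Lemma tensor_add0 : left_id (tens_sum [::]) tensor_add.
Proof. by move=> a; have [s ->] := tens_sum_ex a; rewrite tensor_addE. Qed.

Lemma tensor_addN : left_inverse (tens_sum [::]) tensor_opp tensor_add.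
Proof.
move=> a; have [s ->] := tens_sum_ex a; rewrite tensor_oppE tensor_addE.
apply/tens_sumP; elim: s => [|[t n] s IH] /=; first exact: tens_refl.
apply: (@tens_trans _ ([:: (- t, n)] ++ [:: (t, n)] ++ (map tens_neg s ++ s))).
  apply: (@tens_cat [:: (- t, n)]); first exact: tens_refl.
  rewrite -cat1s !catA; apply: tens_cat; last exact: tens_refl.
  exact: tens_catC.
apply: (@tens_cat [:: (- t, n); (t, n)] [::] _ [::]) => //=.
apply: tens_trans (tens_0l n); apply: tens_sym.
by have := tens_addl (- t) t n; rewrite addNr.
Qed.

HB.instance Definition _ := GRing.isZmodule.Build tensor
  tensor_addA tensor_addC tensor_add0 tensor_addN.

Lemma tens_sumE s : tens_sum s = \sum_(x <- s) tens x.1 x.2.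
Proof.
elim: s => [|[t n] s IH]; first by rewrite big_nil.
by rewrite big_cons -IH /= -[tens _ _ + _]/(tensor_add _ _) tensor_addE.
Qed.

Lemma tensor_universal (G : zmodType) (b : T -> N -> G) :
  (forall t t' n, b (t + t') n = b t n + b t' n) ->
  (forall t n n', b t (n + n') = b t n + b t n') ->
  (forall r t n, b (r *: t) n = b t (r *: n)) ->
  exists! f : tensor -> G,
    (forall x y, f (x + y) = f x + f y) /\ (forall t n, f (tens t n) = b t n).
Proof.
move=> bDl bDr bZ; pose g (s : seq (T * N)) : G := \sum_(x <- s) b x.1 x.2.
have b0l n : b 0 n = 0 by apply: (addrI (b 0 n)); rewrite -bDl !addr0.
have b0r t : b t 0 = 0 by apply: (addrI (b t 0)); rewrite -bDr !addr0.
have gP s t : tens_rel s t -> g s = g t.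
  elim=> {s t} //=; rewrite /g.
  - by move=> s t u _ -> _ ->.
  - by move=> s s' t t' _ h _ h'; rewrite !big_cat h h'.
  - by move=> s t; rewrite !big_cat /= addrC.
  - by move=> n; rewrite big_seq1 big_nil.
  - by move=> n; rewrite big_seq1 big_nil.
  - by move=> t t' n; rewrite big_seq1 big_cons big_seq1 bDl.
  - by move=> t n n'; rewrite big_seq1 big_cons big_seq1 bDr.
  - by move=> r t n; rewrite !big_seq1 /= bZ.
exists (g \o tensor_rep); split=> [|f [fD fT]]; first split=> [x y|t n] /=.
- have [s ->] := tens_sum_ex x; have [t ->] := tens_sum_ex y.
  rewrite -[tens_sum s + _]/(tensor_add _ _) tensor_addE.
  by rewrite !(gP _ _ (tensor_repP _)) /g big_cat.
- by rewrite (gP _ _ (tensor_repP _)) /g big_seq1.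
- apply/funext => x; have [s ->] := tens_sum_ex x => /=.
  rewrite (gP _ _ (tensor_repP _)) tens_sumE /g.
  elim: s => [|y s IH]; last by rewrite !big_cons IH fD fT.
  by rewrite !big_nil; apply: (addrI (f 0)); rewrite -fD !addr0.
Qed.

End Tensor.

Section Purity.
Variable R : comPzRingType.

Definition tensor_map (T L N : lmodType R) (i : L -> N) (a : tensor T L) :
  tensor T N := tens_sum (map (fun x => (x.1, i x.2)) (tensor_rep a)).

Lemma tens_rel_map (T L N : lmodType R) (i : {linear L -> N})
    (s t : seq (T * L)) :
  tens_rel s t ->
  tens_rel (map (fun x => (x.1, i x.2)) s) (map (fun x => (x.1, i x.2)) t).
Proof.
elim=> {s t} //=.
- by move=> s; constructor.
- by move=> s t _; exact: tens_sym.
- by move=> s t u _ h _; exact: tens_trans.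
- by move=> s s' t t' _ h _ h'; rewrite !map_cat; exact: tens_cat.
- by move=> s t; rewrite !map_cat; exact: tens_catC.
- by move=> n; constructor.
- by move=> t; rewrite linear0; constructor.
- by move=> t t' n; constructor.
- by move=> t n n'; rewrite linearD; constructor.
- by move=> r t n; rewrite linearZ; constructor.
Qed.

Lemma tensor_mapE (T L N : lmodType R) (i : {linear L -> N}) s :
  tensor_map (T := T) i (tens_sum s) =
  tens_sum (map (fun x => (x.1, i x.2)) s).
Proof.
by apply/tens_sumP; apply: tens_rel_map; exact: tensor_repP.
Qed.

(* Submodules are presented as injective linear maps. *)
Definition pure_mono (L N : lmodType R) (i : {linear L -> N}) : Prop :=
  forall T : lmodType R, injective (tensor_map (T := T) i).

Definition absolutely_pure (A : lmodType R) : Prop :=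
  forall (N : lmodType R) (i : {linear A -> N}), injective i -> pure_mono i.

End Purity.

Section Opens.
Variable X : topologicalType.

Record opens : Type := Opens { oset :> set X; openP : open oset }.

Definition opensI (U V : opens) : opens :=
  Opens (openI (openP U) (openP V)).

Definition opensT : opens := Opens (@openT X).

Lemma opensIl (U V : opens) : opensI U V `<=` U.
Proof. by move=> y []. Qed.

Lemma opensIr (U V : opens) : opensI U V `<=` V.
Proof. by move=> y []. Qed.

End Opens.

Record presheaf (X : topologicalType) : Type := Presheaf {
  sec :> opens X -> Type;
  res : forall U V : opens X, V `<=` U -> sec U -> sec V;
  res_id : forall (U : opens X) (h : U `<=` U) (s : sec U), res h s = s;
  res_comp : forall (U V W : opens X) (hVU : V `<=` U) (hWV : W `<=` V)
    (hWU : W `<=` U) (s : sec U), res hWV (res hVU s) = res hWU s }.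

Definition is_sheaf (X : topologicalType) (F : presheaf X) : Prop :=
  forall (U : opens X) (I : Type) (V : I -> opens X)
    (hV : forall i, V i `<=` U) (s : forall i, F (V i)),
  U `<=` \bigcup_i V i ->
  (forall (i j : I) (hi : opensI (V i) (V j) `<=` V i)
     (hj : opensI (V i) (V j) `<=` V j), res hi (s i) = res hj (s j)) ->
  exists! t : F U, forall i, res (hV i) t = s i.

Record ringSheaf (X : topologicalType) : Type := RingSheaf {
  rsec :> opens X -> comPzRingType;
  rres : forall U V : opens X, V `<=` U -> {rmorphism rsec U -> rsec V};
  rres_id : forall (U : opens X) (h : U `<=` U) (s : rsec U), rres h s = s;
  rres_comp : forall (U V W : opens X) (hVU : V `<=` U) (hWV : W `<=` V)
    (hWU : W `<=` U) (s : rsec U), rres hWV (rres hVU s) = rres hWU s;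
  rsheafP : is_sheaf (Presheaf rres_id rres_comp) }.

Definition rpresheaf (X : topologicalType) (O : ringSheaf X) : presheaf X :=
  Presheaf (@rres_id X O) (@rres_comp X O).

Record modSheaf (X : topologicalType) (O : ringSheaf X) : Type := ModSheaf {
  msec :> forall U : opens X, lmodType (O U);
  mres : forall U V : opens X, V `<=` U -> {additive msec U -> msec V};
  mresZ : forall (U V : opens X) (h : V `<=` U) (a : O U) (s : msec U),
    mres h (a *: s) = rres O h a *: mres h s;
  mres_id : forall (U : opens X) (h : U `<=` U) (s : msec U), mres h s = s;
  mres_comp : forall (U V W : opens X) (hVU : V `<=` U) (hWV : W `<=` V)
    (hWU : W `<=` U) (s : msec U), mres hWV (mres hVU s) = mres hWU s;
  msheafP : is_sheaf (Presheaf mres_id mres_comp) }.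

Definition mpresheaf (X : topologicalType) (O : ringSheaf X)
    (F : modSheaf O) : presheaf X :=
  Presheaf (@mres_id X O F) (@mres_comp X O F).

Section Stalk.
Variables (X : topologicalType) (F : presheaf X) (x : X).

Record germ_rep : Type := GermRep {
  gopen : opens X; gmem : oset gopen x; gsec : F gopen }.

HB.instance Definition _ := gen_eqMixin germ_rep.
HB.instance Definition _ := gen_choiceMixin germ_rep.

Definition germ_rel (a b : germ_rep) : Prop :=
  exists (W : opens X) (ha : W `<=` gopen a) (hb : W `<=` gopen b),
    oset W x /\ res ha (gsec a) = res hb (gsec b).

Definition germ_eqv : rel germ_rep := fun a b => `[< germ_rel a b >].

Lemma germ_eqv_class : equiv_class_of germ_eqv.
Proof.
split=> [a|a b|b a c].
- by apply/asboolP; exists (gopen a), (fun _ h => h), (fun _ h => h); split;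
    [exact: gmem|].
- by apply/asboolP/asboolP => -[W [h [h' [Wx e]]]]; exists W, h', h.
- move=> /asboolP[W [h1 [h2 [Wx e]]]] /asboolP[W' [h1' [h2' [Wx' e']]]].
  apply/asboolP; exists (opensI W W').
  pose l := @opensIl _ W W'; pose r := @opensIr _ W W'.
  exists (subset_trans l h1), (subset_trans r h2'); split=> //.
  rewrite -(res_comp h1 l) e -(res_comp h2' r).
  by rewrite -e' !(res_comp _ _ (subset_trans l h2)).
Qed.

Canonical germ_equiv := EquivRelPack germ_eqv_class.

Definition stalk : Type := {eq_quot germ_equiv}.
HB.instance Definition _ := Choice.on stalk.

Definition germ (U : opens X) (hx : oset U x) (s : F U) : stalk :=
  \pi_({eq_quot germ_equiv}) (GermRep hx s).

Definition stalk_rep (a : stalk) : germ_rep := repr (a : {eq_quot germ_equiv}).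

Lemma germP (U V : opens X) (hU : oset U x) (hV : oset V x) (s : F U) (t : F V) :
  germ hU s = germ hV t <->
  exists (W : opens X) (h : W `<=` U) (h' : W `<=` V),
    oset W x /\ res h s = res h' t.
Proof.
split=> [/eqquotP/asboolP//|h].
by apply/eqquotP/asboolP.
Qed.

Lemma stalk_repK (a : stalk) : germ (gmem (stalk_rep a)) (gsec (stalk_rep a)) = a.
Proof.
rewrite /germ.
have -> : GermRep (gmem (stalk_rep a)) (gsec (stalk_rep a)) = stalk_rep a.
  by case: (stalk_rep a).
by rewrite /stalk_rep reprK.
Qed.

Lemma germ_res (U V : opens X) (hU : oset U x) (hV : oset V x) (h : V `<=` U) (s : F U) :
  germ hV (res h s) = germ hU s.
Proof. by apply/germP; exists V, (fun _ y => y), h; rewrite res_id. Qed.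

Lemma germ_ex (a : stalk) : exists (U : opens X) (hU : oset U x) (s : F U),
  a = germ hU s.
Proof.
by exists (gopen (stalk_rep a)), (gmem (stalk_rep a)), (gsec (stalk_rep a));
  rewrite stalk_repK.
Qed.

End Stalk.

Section StalkOps.
Variables (X : topologicalType) (x : X).

Lemma germ_ex2 (F G : presheaf X) (a : stalk F x) (b : stalk G x) :
  exists (U : opens X) (hU : oset U x) (s : F U) (t : G U),
  a = germ hU s /\ b = germ hU t.
Proof.
have [U [hU [s ->]]] := germ_ex a; have [V [hV [t ->]]] := germ_ex b.
have hW : oset (opensI U V) x by [].
exists (opensI U V), hW, (res (@opensIl _ _ _) s), (res (@opensIr _ _ _) t).
by rewrite !(germ_res _ hW).
Qed.

Lemma germ_ex3 (F G H : presheaf X) (a : stalk F x) (b : stalk G x)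
    (c : stalk H x) :
  exists (U : opens X) (hU : oset U x) (s : F U) (t : G U) (u : H U),
  [/\ a = germ hU s, b = germ hU t & c = germ hU u].
Proof.
have [U [hU [s [t [-> ->]]]]] := germ_ex2 a b; have [V [hV [u ->]]] := germ_ex c.
have hW : oset (opensI U V) x by [].
exists (opensI U V), hW, (res (@opensIl _ _ _) s), (res (@opensIl _ _ _) t).
by exists (res (@opensIr _ _ _) u); rewrite !(germ_res _ hW).
Qed.

Definition stalk_map (F G : presheaf X) (op : forall U, F U -> G U)
    (a : stalk F x) : stalk G x :=
  germ (gmem (stalk_rep a)) (op _ (gsec (stalk_rep a))).

Lemma stalk_mapE (F G : presheaf X) (op : forall U, F U -> G U) :
  (forall (U V : opens X) (h : V `<=` U) s, res h (op U s) = op V (res h s)) ->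
  forall (U : opens X) (hU : oset U x) s,
  stalk_map op (germ hU s) = germ hU (op U s).
Proof.
move=> opP U hU s; rewrite /stalk_map.
have /germP[W [h [h' [Wx e]]]] := stalk_repK (germ hU s).
by apply/germP; exists W, h, h'; rewrite !opP e.
Qed.

Definition stalk_map2 (F G H : presheaf X) (op : forall U, F U -> G U -> H U)
    (a : stalk F x) (b : stalk G x) : stalk H x :=
  germ (U := opensI (gopen (stalk_rep a)) (gopen (stalk_rep b)))
    (conj (gmem (stalk_rep a)) (gmem (stalk_rep b)))
    (op _ (res (@opensIl _ _ _) (gsec (stalk_rep a)))
          (res (@opensIr _ _ _) (gsec (stalk_rep b)))).

Lemma stalk_map2E (F G H : presheaf X) (op : forall U, F U -> G U -> H U) :
  (forall (U V : opens X) (h : V `<=` U) s t,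
    res h (op U s t) = op V (res h s) (res h t)) ->
  forall (U : opens X) (hU : oset U x) s t,
  stalk_map2 op (germ hU s) (germ hU t) = germ hU (op U s t).
Proof.
move=> opP U hU s t; rewrite /stalk_map2.
have /germP[W [h [h' [Wx e]]]] := stalk_repK (germ hU s).
have /germP[V [k [k' [Vx e']]]] := stalk_repK (germ hU t).
have hWV : opensI W V `<=` opensI (gopen (stalk_rep (germ hU s)))
   (gopen (stalk_rep (germ hU t))) by move=> y [/h ? /k ?].
have hWVU : opensI W V `<=` U by move=> y [/h' ? _].
apply/germP; exists (opensI W V), hWV, hWVU; split=> //.
rewrite !opP; congr (op _ _ _).
  rewrite (res_comp _ _ (subset_trans (@opensIl _ _ _) h)).
  rewrite -(res_comp h (@opensIl _ _ _)) e.
  by rewrite (res_comp _ _ hWVU).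
rewrite (res_comp _ _ (subset_trans (@opensIr _ _ _) k)).
rewrite -(res_comp k (@opensIr _ _ _)) e'.
by rewrite (res_comp _ _ hWVU).
Qed.

End StalkOps.

Section RingStalk.
Variables (X : topologicalType) (O : ringSheaf X) (x : X).

Definition rstalk : Type := stalk (rpresheaf O) x.
HB.instance Definition _ := Choice.on rstalk.

Definition rgerm (U : opens X) (hU : oset U x) (s : O U) : rstalk :=
  germ (F := rpresheaf O) hU s.

Definition rstalk_add : rstalk -> rstalk -> rstalk :=
  stalk_map2 (F := rpresheaf O) (G := rpresheaf O) (H := rpresheaf O)
    (fun U => +%R : O U -> O U -> O U).
Definition rstalk_mul : rstalk -> rstalk -> rstalk :=
  stalk_map2 (F := rpresheaf O) (G := rpresheaf O) (H := rpresheaf O)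
    (fun U => *%R : O U -> O U -> O U).
Definition rstalk_opp : rstalk -> rstalk :=
  stalk_map (F := rpresheaf O) (G := rpresheaf O) (fun U => -%R : O U -> O U).
Definition rstalk_cst (r : forall U, O U) : rstalk :=
  rgerm (U := opensT X) I (r _).

Lemma rstalk_addE (U : opens X) (hU : oset U x) (s t : O U) :
  rstalk_add (rgerm hU s) (rgerm hU t) =
  rgerm hU (s + t).
Proof. by rewrite /rstalk_add stalk_map2E// => *; exact: rmorphD. Qed.

Lemma rstalk_mulE (U : opens X) (hU : oset U x) (s t : O U) :
  rstalk_mul (rgerm hU s) (rgerm hU t) =
  rgerm hU (s * t).
Proof. by rewrite /rstalk_mul stalk_map2E// => *; exact: rmorphM. Qed.

Lemma rstalk_oppE (U : opens X) (hU : oset U x) (s : O U) :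
  rstalk_opp (rgerm hU s) = rgerm hU (- s).
Proof. by rewrite /rstalk_opp stalk_mapE// => *; exact: rmorphN. Qed.

Lemma rstalk_zeroE (U : opens X) (hU : oset U x) :
  rstalk_cst (fun=> 0) = rgerm hU 0.
Proof.
rewrite /rstalk_cst /rgerm -(@germ_res _ (rpresheaf O) x (opensT X) U I hU
  (fun _ _ => I)) /=.
by rewrite rmorph0.
Qed.

Lemma rstalk_oneE (U : opens X) (hU : oset U x) :
  rstalk_cst (fun=> 1) = rgerm hU 1.
Proof.
rewrite /rstalk_cst /rgerm -(@germ_res _ (rpresheaf O) x (opensT X) U I hU
  (fun _ _ => I)) /=.
by rewrite rmorph1.
Qed.

Lemma rstalk_addA : associative rstalk_add.
Proof.
move=> a b c; have [U [hU [s [t [u [-> -> ->]]]]]] := germ_ex3 a b c.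
by rewrite -!/(rgerm _ _) !rstalk_addE addrA.
Qed.
Lemma rstalk_addC : commutative rstalk_add.
Proof.
move=> a b; have [U [hU [s [t [-> ->]]]]] := germ_ex2 a b.
by rewrite -!/(rgerm _ _) !rstalk_addE addrC.
Qed.
Lemma rstalk_add0 : left_id (rstalk_cst (fun=> 0)) rstalk_add.
Proof.
move=> a; have [U [hU [s ->]]] := germ_ex a.
by rewrite -/(rgerm _ _) (rstalk_zeroE hU) rstalk_addE add0r.
Qed.
Lemma rstalk_addN : left_inverse (rstalk_cst (fun=> 0)) rstalk_opp rstalk_add.
Proof.
move=> a; have [U [hU [s ->]]] := germ_ex a.
by rewrite -/(rgerm _ _) (rstalk_zeroE hU) rstalk_oppE rstalk_addE addNr.
Qed.
HB.instance Definition _ := GRing.isZmodule.Build rstalk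
  rstalk_addA rstalk_addC rstalk_add0 rstalk_addN.

Lemma rgermD (U : opens X) (hU : oset U x) (s t : O U) :
  rgerm hU (s + t) = rgerm hU s + rgerm hU t.
Proof. by rewrite -[RHS]/(rstalk_add _ _) rstalk_addE. Qed.

Lemma rstalk_mulA : associative rstalk_mul.
Proof.
move=> a b c; have [U [hU [s [t [u [-> -> ->]]]]]] := germ_ex3 a b c.
by rewrite -!/(rgerm _ _) !rstalk_mulE mulrA.
Qed.
Lemma rstalk_mulC : commutative rstalk_mul.
Proof.
move=> a b; have [U [hU [s [t [-> ->]]]]] := germ_ex2 a b.
by rewrite -!/(rgerm _ _) !rstalk_mulE mulrC.
Qed.
Lemma rstalk_mul1 : left_id (rstalk_cst (fun=> 1)) rstalk_mul.
Proof.
move=> a; have [U [hU [s ->]]] := germ_ex a.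
by rewrite -/(rgerm _ _) (rstalk_oneE hU) rstalk_mulE mul1r.
Qed.
Lemma rstalk_mulDl : left_distributive rstalk_mul +%R.
Proof.
move=> a b c; have [U [hU [s [t [u [-> -> ->]]]]]] := germ_ex3 a b c.
by rewrite -!/(rgerm _ _) -rgermD !rstalk_mulE -rgermD mulrDl.
Qed.
HB.instance Definition _ := GRing.Zmodule_isComPzRing.Build rstalk
  rstalk_mulA rstalk_mulC rstalk_mul1 rstalk_mulDl.

Lemma rgermM (U : opens X) (hU : oset U x) (s t : O U) :
  rgerm hU (s * t) = rgerm hU s * rgerm hU t.
Proof. by rewrite -[RHS]/(rstalk_mul _ _) rstalk_mulE. Qed.

Lemma rgerm1 (U : opens X) (hU : oset U x) : rgerm hU 1 = 1.
Proof. by rewrite -rstalk_oneE. Qed.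

End RingStalk.

Section ModStalk.
Variables (X : topologicalType) (O : ringSheaf X) (F : modSheaf O) (x : X).

Definition mstalk : Type := stalk (mpresheaf F) x.
HB.instance Definition _ := Choice.on mstalk.

Definition mgerm (U : opens X) (hU : oset U x) (s : F U) : mstalk :=
  germ (F := mpresheaf F) hU s.

Definition mstalk_add : mstalk -> mstalk -> mstalk :=
  stalk_map2 (F := mpresheaf F) (G := mpresheaf F) (H := mpresheaf F)
    (fun U => +%R : F U -> F U -> F U).
Definition mstalk_opp : mstalk -> mstalk :=
  stalk_map (F := mpresheaf F) (G := mpresheaf F) (fun U => -%R : F U -> F U).
Definition mstalk_zero : mstalk :=
  mgerm (U := opensT X) I (0 : F _).
Definition mstalk_scale : rstalk O x -> mstalk -> mstalk :=
  stalk_map2 (F := rpresheaf O) (G := mpresheaf F) (H := mpresheaf F)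
    (fun U => *:%R : O U -> F U -> F U).

Lemma mstalk_addE (U : opens X) (hU : oset U x) (s t : F U) :
  mstalk_add (mgerm hU s) (mgerm hU t) =
  mgerm hU (s + t).
Proof. by rewrite /mstalk_add stalk_map2E// => *; exact: raddfD. Qed.

Lemma mstalk_oppE (U : opens X) (hU : oset U x) (s : F U) :
  mstalk_opp (mgerm hU s) = mgerm hU (- s).
Proof. by rewrite /mstalk_opp stalk_mapE// => *; exact: raddfN. Qed.

Lemma mstalk_zeroE (U : opens X) (hU : oset U x) :
  mstalk_zero = mgerm hU (0 : F U).
Proof.
rewrite /mstalk_zero /mgerm -(@germ_res _ (mpresheaf F) x (opensT X) U I hU
  (fun _ _ => I)) /=.
by rewrite raddf0.
Qed.

Lemma mstalk_scaleE (U : opens X) (hU : oset U x) (a : O U) (s : F U) :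
  mstalk_scale (rgerm hU a) (mgerm hU s) =
  mgerm hU (a *: s).
Proof. by rewrite /mstalk_scale stalk_map2E// => *; exact: mresZ. Qed.

Lemma mstalk_addA : associative mstalk_add.
Proof.
move=> a b c; have [U [hU [s [t [u [-> -> ->]]]]]] := germ_ex3 a b c.
by rewrite -!/(mgerm _ _) !mstalk_addE addrA.
Qed.
Lemma mstalk_addC : commutative mstalk_add.
Proof.
move=> a b; have [U [hU [s [t [-> ->]]]]] := germ_ex2 a b.
by rewrite -!/(mgerm _ _) !mstalk_addE addrC.
Qed.
Lemma mstalk_add0 : left_id mstalk_zero mstalk_add.
Proof.
move=> a; have [U [hU [s ->]]] := germ_ex a.
by rewrite -/(mgerm _ _) (mstalk_zeroE hU) mstalk_addE add0r.
Qed.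
Lemma mstalk_addN : left_inverse mstalk_zero mstalk_opp mstalk_add.
Proof.
move=> a; have [U [hU [s ->]]] := germ_ex a.
by rewrite -/(mgerm _ _) (mstalk_zeroE hU) mstalk_oppE mstalk_addE addNr.
Qed.
HB.instance Definition _ := GRing.isZmodule.Build mstalk
  mstalk_addA mstalk_addC mstalk_add0 mstalk_addN.

Lemma mgermD (U : opens X) (hU : oset U x) (s t : F U) :
  mgerm hU (s + t) = mgerm hU s + mgerm hU t.
Proof. by rewrite -[RHS]/(mstalk_add _ _) mstalk_addE. Qed.

Lemma mstalk_scaleA (a b : rstalk O x) (v : mstalk) :
  mstalk_scale a (mstalk_scale b v) = mstalk_scale (a * b) v.
Proof.
have [U [hU [s [t [u [-> -> ->]]]]]] := germ_ex3 a b v.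
by rewrite -!/(rgerm _ _) -!/(mgerm _ _) -rgermM !mstalk_scaleE scalerA.
Qed.
Lemma mstalk_scale1 : left_id 1 mstalk_scale.
Proof.
move=> v; have [U [hU [s ->]]] := germ_ex v.
by rewrite -/(mgerm _ _) -(rgerm1 O hU) mstalk_scaleE scale1r.
Qed.
Lemma mstalk_scaleDr : right_distributive mstalk_scale +%R.
Proof.
move=> a v w; have [U [hU [s [t [u [-> -> ->]]]]]] := germ_ex3 a v w.
by rewrite -!/(rgerm _ _) -!/(mgerm _ _) -mgermD !mstalk_scaleE -mgermD scalerDr.
Qed.
Lemma mstalk_scaleDl (v : mstalk) : {morph mstalk_scale^~ v : a b / a + b}.
Proof.
move=> a b; have [U [hU [s [t [u [-> -> ->]]]]]] := germ_ex3 a b v.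
by rewrite -!/(rgerm _ _) -!/(mgerm _ _) -rgermD !mstalk_scaleE -mgermD scalerDl.
Qed.
HB.instance Definition _ := GRing.Zmodule_isLmodule.Build (rstalk O x) mstalk
  mstalk_scaleA mstalk_scale1 mstalk_scaleDr mstalk_scaleDl.

Lemma mgermZ (U : opens X) (hU : oset U x) (a : O U) (s : F U) :
  mgerm hU (a *: s) = rgerm hU a *: mgerm hU s.
Proof. by rewrite -[RHS]/(mstalk_scale _ _) mstalk_scaleE. Qed.

End ModStalk.

Section Spec.
Variable A : comPzRingType.

Record spec : Type := Spec { prime_set : set A; spec_prime : prime_ideal prime_set }.

HB.instance Definition _ := gen_eqMixin spec.
HB.instance Definition _ := gen_choiceMixin spec.

Definition zariski_closed (E : set A) : set spec :=
  [set p | E `<=` prime_set p].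

Definition zariski_open (U : set spec) : Prop :=
  exists E : set A, U = ~` zariski_closed E.

Lemma spec1 (p : spec) : ~ prime_set p 1.
Proof. by case: (spec_prime p). Qed.

Lemma specM (p : spec) (a b : A) :
  ~ prime_set p a -> ~ prime_set p b -> ~ prime_set p (a * b).
Proof. by move=> ha hb; case: (spec_prime p) => _ _ h /h[]. Qed.

Lemma zariski_openT : zariski_open setT.
Proof.
exists setT; apply/seteqP; split=> // p _ /(_ 1 I); exact: spec1.
Qed.

Lemma zariski_openI : setI_closed zariski_open.
Proof.
move=> _ _ [E ->] [F ->]; exists [set z | exists2 e, E e & exists2 f, F f & z = e * f].
apply/seteqP; split=> p /=.
- move=> [/existsNP[e /not_implyP[Ee pe]] /existsNP[f /not_implyP[Ff pf]]] h.
  by apply: (specM pe pf); apply: h; exists e => //; exists f.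
- move=> h; split=> h'; apply: h => _ [e Ee [f Ff ->]].
    rewrite mulrC; case: (spec_prime p) => -[_ _ hM] _ _; apply: hM; exact: h'.
  by case: (spec_prime p) => -[_ _ hM] _ _; apply: hM; exact: h'.
Qed.

Lemma zariski_open_bigU (I : Type) (f : I -> set spec) :
  (forall i, zariski_open (f i)) -> zariski_open (\bigcup_i f i).
Proof.
move=> /choice[E hE]; exists (\bigcup_i E i); apply/seteqP; split=> p /=.
- by move=> [i _]; rewrite hE => hp h; apply: hp => a Ea; apply: h; exists i.
- move=> /existsNP[a /not_implyP[[i _ Ea] pa]]; exists i => //.
  by rewrite hE => h; apply: pa; exact: h.
Qed.

HB.instance Definition _ := isOpenTopological.Build spec
  zariski_openT zariski_openI zariski_open_bigU.

End Spec.

Section Localization.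
Variables (A : comPzRingType) (p : spec A) (M : lmodType A).

Record frac_rep : Type := FracRep {
  fnum : M; fden : A; fdenP : ~ prime_set p fden }.
Arguments fdenP : clear implicits.

HB.instance Definition _ := gen_eqMixin frac_rep.
HB.instance Definition _ := gen_choiceMixin frac_rep.

Definition frac_rel (a b : frac_rep) : Prop :=
  exists u : A, ~ prime_set p u /\
    u *: (fden b *: fnum a) = u *: (fden a *: fnum b).

Definition frac_eqv : rel frac_rep := fun a b => `[< frac_rel a b >].

Lemma frac_eqv_class : equiv_class_of frac_eqv.
Proof.
split=> [a|a b|b a c].
- by apply/asboolP; exists 1; split=> //; exact: spec1.
- by apply/asboolP/asboolP => -[u [hu e]]; exists u.
- move=> /asboolP[u [hu e]] /asboolP[v [hv e']]; apply/asboolP.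
  exists (u * v * fden b); split; first exact: specM (specM hu hv) (fdenP b).
  transitivity ((v * fden c) *: (u *: (fden b *: fnum a))).
    by rewrite !scalerA; congr (_ *: _); ring.
  rewrite e; transitivity ((u * fden a) *: (v *: (fden c *: fnum b))).
    by rewrite !scalerA; congr (_ *: _); ring.
  by rewrite e' !scalerA; congr (_ *: _); ring.
Qed.

Canonical frac_equiv := EquivRelPack frac_eqv_class.

Definition localization : Type := {eq_quot frac_equiv}.
HB.instance Definition _ := Choice.on localization.

Definition frac (m : M) (a : A) (ha : ~ prime_set p a) : localization :=
  \pi_({eq_quot frac_equiv}) (FracRep m ha).

Definition loc_rep (z : localization) : frac_rep :=
  repr (z : {eq_quot frac_equiv}).

Lemma fracP m a (ha : ~ prime_set p a) n b (hb : ~ prime_set p b) :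
  frac m ha = frac n hb <->
  exists u : A, ~ prime_set p u /\ u *: (b *: m) = u *: (a *: n).
Proof.
split=> [/eqquotP/asboolP//|h].
by apply/eqquotP/asboolP.
Qed.

Lemma frac_eq m a (ha : ~ prime_set p a) n b (hb : ~ prime_set p b) :
  b *: m = a *: n -> frac m ha = frac n hb.
Proof. by move=> e; apply/fracP; exists 1; rewrite e; split=> //; exact: spec1. Qed.

Lemma loc_repK z : frac (fnum (loc_rep z)) (fdenP (loc_rep z)) = z.
Proof.
rewrite /frac.
have -> : FracRep (fnum (loc_rep z)) (fdenP (loc_rep z)) = loc_rep z.
  by case: (loc_rep z).
by rewrite /loc_rep reprK.
Qed.

Lemma frac_ex z : exists m a (ha : ~ prime_set p a), z = frac m ha.
Proof. by exists (fnum (loc_rep z)), (fden (loc_rep z)), (fdenP (loc_rep z));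
  rewrite loc_repK. Qed.

Definition loc_add (y z : localization) : localization :=
  frac (fden (loc_rep z) *: fnum (loc_rep y) + fden (loc_rep y) *: fnum (loc_rep z))
    (specM (fdenP (loc_rep y)) (fdenP (loc_rep z))).
Definition loc_opp (z : localization) : localization :=
  frac (- fnum (loc_rep z)) (fdenP (loc_rep z)).
Definition loc_zero : localization := frac 0 (@spec1 A p).

Lemma loc_addE m a (ha : ~ prime_set p a) n b (hb : ~ prime_set p b)
    (hab : ~ prime_set p (a * b)) :
  loc_add (frac m ha) (frac n hb) = frac (b *: m + a *: n) hab.
Proof.
rewrite /loc_add; have /fracP[u [hu e]] := loc_repK (frac m ha).
have /fracP[v [hv e']] := loc_repK (frac n hb).
move: (loc_rep (frac m ha)) (loc_rep (frac n hb)) e e' =>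
  [m' a' ha'] [n' b' hb'] /= e e'.
apply/fracP; exists (u * v); split; first exact: specM.
rewrite !scalerDr !scalerA; congr (_ + _).
  transitivity ((v * b * b') *: (u *: (a *: m'))).
    by rewrite !scalerA; congr (_ *: _); ring.
  by rewrite e !scalerA; congr (_ *: _); ring.
transitivity ((u * a * a') *: (v *: (b *: n'))).
  by rewrite !scalerA; congr (_ *: _); ring.
by rewrite e' !scalerA; congr (_ *: _); ring.
Qed.

Lemma loc_oppE m a (ha : ~ prime_set p a) : loc_opp (frac m ha) = frac (- m) ha.
Proof.
rewrite /loc_opp; have /fracP[u [hu e]] := loc_repK (frac m ha).
by apply/fracP; exists u; split=> //; rewrite !scalerN e.
Qed.

Lemma loc_addA : associative loc_add.
Proof.
move=> x y z; have [m [a [ha ->]]] := frac_ex x; have [n [b [hb ->]]] := frac_ex y.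
have [q [c [hc ->]]] := frac_ex z.
have hab := specM ha hb; have hbc := specM hb hc.
rewrite !(loc_addE _ _ _ _ hab) !(loc_addE _ _ _ _ hbc).
rewrite (loc_addE _ _ _ _ (specM ha hbc)) (loc_addE _ _ _ _ (specM hab hc)).
apply: frac_eq; rewrite !scalerDr !scalerA -!addrA.
by congr (_ *: _ + (_ *: _ + _ *: _)); ring.
Qed.

Lemma loc_addC : commutative loc_add.
Proof.
move=> x y; have [m [a [ha ->]]] := frac_ex x; have [n [b [hb ->]]] := frac_ex y.
rewrite (loc_addE _ _ _ _ (specM ha hb)) (loc_addE _ _ _ _ (specM hb ha)).
by apply: frac_eq; rewrite addrC mulrC.
Qed.

Lemma loc_add0 : left_id loc_zero loc_add.
Proof.
move=> x; have [m [a [ha ->]]] := frac_ex x.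
rewrite (loc_addE _ _ _ _ (specM (@spec1 A p) ha)).
by apply: frac_eq; rewrite scaler0 add0r scale1r mul1r.
Qed.

Lemma loc_addN : left_inverse loc_zero loc_opp loc_add.
Proof.
move=> x; have [m [a [ha ->]]] := frac_ex x.
rewrite loc_oppE (loc_addE _ _ _ _ (specM ha ha)).
by apply: frac_eq; rewrite scalerN addNr !scaler0.
Qed.

HB.instance Definition _ := GRing.isZmodule.Build localization
  loc_addA loc_addC loc_add0 loc_addN.

Lemma fracD m a (ha : ~ prime_set p a) n b (hb : ~ prime_set p b)
    (hab : ~ prime_set p (a * b)) :
  frac m ha + frac n hb = frac (b *: m + a *: n) hab.
Proof. exact: loc_addE. Qed.

Lemma fracN m a (ha : ~ prime_set p a) : - frac m ha = frac (- m) ha.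
Proof. exact: loc_oppE. Qed.

Lemma frac0 a (ha : ~ prime_set p a) : frac 0 ha = 0.
Proof. by apply: frac_eq; rewrite !scaler0. Qed.

End Localization.

Arguments fdenP {A p M} f.

Section LocalizationScale.
Variables (A : comPzRingType) (p : spec A).

Definition locring : Type := localization p A^o.
HB.instance Definition _ := GRing.Zmodule.on locring.

Definition rfrac (c a : A) (ha : ~ prime_set p a) : locring :=
  frac (c : A^o) ha.

Definition loc_scale (M : lmodType A) (y : locring) (z : localization p M) :
    localization p M :=
  frac ((fnum (loc_rep y) : A) *: fnum (loc_rep z))
    (specM (fdenP (loc_rep y)) (fdenP (loc_rep z))).

Lemma loc_scaleE (M : lmodType A) c a (ha : ~ prime_set p a) (m : M) b
    (hb : ~ prime_set p b) (hab : ~ prime_set p (a * b)) :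
  loc_scale (rfrac c ha) (frac m hb) = frac (c *: m) hab.
Proof.
rewrite /loc_scale; have /fracP[u [hu e]] := loc_repK (rfrac c ha).
have /fracP[v [hv e']] := loc_repK (frac m hb).
move: (loc_rep (rfrac c ha)) (loc_rep (frac m hb)) e e' =>
  [c' a' ha'] [m' b' hb'] /= e e'.
apply/fracP; exists (u * v); split; first exact: specM.
transitivity ((u * (a * c')) *: (v *: (b *: m'))).
  by rewrite !scalerA; congr (_ *: _); ring.
rewrite e'; have -> : u * (a * c') = u * (a' * c) by exact: e.
by rewrite !scalerA; congr (_ *: _); ring.
Qed.

Definition locring_mul : locring -> locring -> locring := @loc_scale A^o.

Lemma locring_mulA : associative locring_mul.
Proof.
move=> x y z; have [m [a [ha ->]]] := frac_ex x; have [n [b [hb ->]]] := frac_ex y.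
have [q [c [hc ->]]] := frac_ex z.
have hab := specM ha hb; have hbc := specM hb hc.
rewrite -!/(rfrac _ _) /locring_mul !(loc_scaleE _ _ _ _ hab) !(loc_scaleE _ _ _ _ hbc).
rewrite (loc_scaleE _ _ _ _ (specM ha hbc)) -!/(rfrac _ _).
rewrite (loc_scaleE _ _ _ _ (specM hab hc)).
apply: frac_eq; rewrite -![_ *: _]/(_ * _); ring.
Qed.

Lemma locring_mulC : commutative locring_mul.
Proof.
move=> x y; have [m [a [ha ->]]] := frac_ex x; have [n [b [hb ->]]] := frac_ex y.
rewrite -!/(rfrac _ _) /locring_mul (loc_scaleE _ _ _ _ (specM ha hb)).
rewrite (loc_scaleE _ _ _ _ (specM hb ha)).
apply: frac_eq; rewrite -![_ *: _]/(_ * _); ring.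
Qed.

Lemma loc_scale1 (M : lmodType A) :
  left_id (rfrac 1 (@spec1 A p)) (@loc_scale M).
Proof.
move=> x; have [m [a [ha ->]]] := frac_ex x.
rewrite (loc_scaleE _ _ _ _ (specM (@spec1 A p) ha)).
by apply: frac_eq; rewrite scale1r mul1r.
Qed.

Lemma loc_scaleDl (M : lmodType A) (z : localization p M) :
  {morph (@loc_scale M)^~ z : x y / x + y}.
Proof.
move=> x y; have [m [a [ha ->]]] := frac_ex x; have [n [b [hb ->]]] := frac_ex y.
have [q [c [hc ->]]] := frac_ex z.
have hab := specM ha hb; have hac := specM ha hc; have hbc := specM hb hc.
rewrite (fracD _ _ _ _ hab) -!/(rfrac _ _) (loc_scaleE _ _ _ _ (specM hab hc)).
rewrite (loc_scaleE _ _ _ _ hac) (loc_scaleE _ _ _ _ hbc).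
rewrite (fracD _ _ _ _ (specM hac hbc)); apply: frac_eq.
rewrite -![_ *: (_ : A^o)]/(_ * _) !scalerDr !scalerA -scalerDl.
by congr (_ *: _); ring.
Qed.

Lemma locring_mulDl : left_distributive locring_mul +%R.
Proof. by move=> x y z; exact: loc_scaleDl. Qed.

HB.instance Definition _ := GRing.Zmodule_isComPzRing.Build locring
  locring_mulA locring_mulC (@loc_scale1 A^o) locring_mulDl.

Lemma loc_scaleA (M : lmodType A) (x y : locring) (z : localization p M) :
  loc_scale x (loc_scale y z) = loc_scale (x * y) z.
Proof.
have [m [a [ha ->]]] := frac_ex x; have [n [b [hb ->]]] := frac_ex y.
have [q [c [hc ->]]] := frac_ex z.
have hab := specM ha hb; have hbc := specM hb hc.
rewrite -!/(rfrac _ _) -[_ * _]/(loc_scale _ _) !(loc_scaleE _ _ _ _ hab).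
rewrite !(loc_scaleE _ _ _ _ hbc) (loc_scaleE _ _ _ _ (specM ha hbc)).
rewrite -!/(rfrac _ _) (loc_scaleE _ _ _ _ (specM hab hc)).
by apply: frac_eq; rewrite !scalerA; congr (_ *: _); rewrite -![_ *: _]/(_ * _); ring.
Qed.

Lemma loc_scaleDr (M : lmodType A) : right_distributive (@loc_scale M) +%R.
Proof.
move=> x y z; have [m [a [ha ->]]] := frac_ex x; have [n [b [hb ->]]] := frac_ex y.
have [q [c [hc ->]]] := frac_ex z.
have hab := specM ha hb; have hac := specM ha hc; have hbc := specM hb hc.
rewrite (fracD _ _ _ _ hbc) -!/(rfrac _ _) (loc_scaleE _ _ _ _ (specM ha hbc)).
rewrite (loc_scaleE _ _ _ _ hac) (loc_scaleE _ _ _ _ hab).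
rewrite (fracD _ _ _ _ (specM hab hac)); apply: frac_eq.
rewrite !scalerDr !scalerA.
by congr (_ *: _ + _ *: _); ring.
Qed.

HB.instance Definition _ (M : lmodType A) :=
  GRing.Zmodule_isLmodule.Build locring (localization p M)
  (@loc_scaleA M) (@loc_scale1 M) (@loc_scaleDr M) (@loc_scaleDl M).

Lemma rfracM c a (ha : ~ prime_set p a) d b (hb : ~ prime_set p b)
    (hab : ~ prime_set p (a * b)) :
  rfrac c ha * rfrac d hb = rfrac (c * d) hab.
Proof. exact: loc_scaleE. Qed.

Lemma fracZ (M : lmodType A) c a (ha : ~ prime_set p a) (m : M) b
    (hb : ~ prime_set p b) (hab : ~ prime_set p (a * b)) :
  rfrac c ha *: frac m hb = frac (c *: m) hab.
Proof. exact: loc_scaleE. Qed.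

End LocalizationScale.

(* Sections over U of the sheaf associated with M: families of elements of the
   localizations M_p, p in U, that are locally given by a single fraction. The
   case M = A is the structure sheaf of Spec A. *)
Section Tilde.
Variables (A : comPzRingType) (M : lmodType A).

Definition locally_fraction (U : opens (spec A))
    (s : forall p : spec A, oset U p -> localization p M) : Prop :=
  forall p, oset U p -> exists V : opens (spec A), [/\ oset V p, V `<=` U &
    exists (m : M) (a : A), forall q (hU : oset U q), oset V q ->
      exists ha : ~ prime_set q a, s q hU = frac m ha].

Record tilde_sec (U : opens (spec A)) : Type := TildeSec {
  tfun : forall p : spec A, oset U p -> localization p M;
  tfunP : locally_fraction tfun }.

HB.instance Definition _ U := gen_eqMixin (tilde_sec U).
HB.instance Definition _ U := gen_choiceMixin (tilde_sec U).

Lemma tilde_ext U (s t : tilde_sec U) :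
  (forall p hp, tfun s (p := p) hp = tfun t hp) -> s = t.
Proof.
case: s t => [s sP] [t tP] /= e.
have {}e : s = t by apply: functional_extensionality_dep => p; apply/funext => hp.
by subst t; congr TildeSec; exact: Prop_irrelevance.
Qed.

Section Zmod.
Variable U : opens (spec A).

Lemma tilde_addP (s t : tilde_sec U) :
  locally_fraction (fun p (hp : oset U p) => tfun s hp + tfun t hp).
Proof.
move=> p hp; have [V [Vp VU [m [a hs]]]] := tfunP s hp.
have [W [Wp WU [n [b ht]]]] := tfunP t hp.
exists (opensI V W); split=> //; first by move=> q [/VU].
exists (b *: m + a *: n), (a * b) => q hU [Vq Wq].
have [ha ->] := hs q hU Vq; have [hb ->] := ht q hU Wq.
by exists (specM ha hb); exact: fracD.
Qed.

Lemma tilde_oppP (s : tilde_sec U) :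
  locally_fraction (fun p (hp : oset U p) => - tfun s hp).
Proof.
move=> p hp; have [V [Vp VU [m [a hs]]]] := tfunP s hp.
exists V; split=> //; exists (- m), a => q hU Vq.
by have [ha ->] := hs q hU Vq; exists ha; exact: fracN.
Qed.

Lemma tilde_zeroP : locally_fraction (fun p (hp : oset U p) => 0).
Proof.
move=> p hp; exists U; split=> //; exists 0, 1 => q hU Uq.
by exists (@spec1 A q); rewrite frac0.
Qed.

Definition tilde_add (s t : tilde_sec U) := TildeSec (tilde_addP s t).
Definition tilde_opp (s : tilde_sec U) := TildeSec (tilde_oppP s).
Definition tilde_zero := TildeSec tilde_zeroP.

Lemma tilde_addA : associative tilde_add.
Proof. by move=> s t u; apply: tilde_ext => p hp /=; rewrite addrA. Qed.

Lemma tilde_addC : commutative tilde_add.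
Proof. by move=> s t; apply: tilde_ext => p hp /=; rewrite addrC. Qed.

Lemma tilde_add0 : left_id tilde_zero tilde_add.
Proof. by move=> s; apply: tilde_ext => p hp /=; rewrite add0r. Qed.

Lemma tilde_addN : left_inverse tilde_zero tilde_opp tilde_add.
Proof. by move=> s; apply: tilde_ext => p hp /=; rewrite addNr. Qed.

HB.instance Definition _ := GRing.isZmodule.Build (tilde_sec U)
  tilde_addA tilde_addC tilde_add0 tilde_addN.

End Zmod.

Lemma tilde_resP (U V : opens (spec A)) (h : V `<=` U) (s : tilde_sec U) :
  locally_fraction (fun p (hp : oset V p) => tfun s (h p hp)).
Proof.
move=> p hp; have [W [Wp WU [m [a hs]]]] := tfunP s (h p hp).
exists (opensI V W); split=> //; first exact: opensIl.
by exists m, a => q hV [_ Wq]; exact: hs.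
Qed.

Definition tilde_res (U V : opens (spec A)) (h : V `<=` U) (s : tilde_sec U) :
  tilde_sec V := TildeSec (tilde_resP h s).

Lemma tilde_res_id (U : opens (spec A)) (h : U `<=` U) (s : tilde_sec U) :
  tilde_res h s = s.
Proof.
by apply: tilde_ext => p hp /=; congr (tfun s _); exact: Prop_irrelevance.
Qed.

Lemma tilde_res_comp (U V W : opens (spec A)) (hVU : V `<=` U) (hWV : W `<=` V)
    (hWU : W `<=` U) (s : tilde_sec U) :
  tilde_res hWV (tilde_res hVU s) = tilde_res hWU s.
Proof.
by apply: tilde_ext => p hp /=; congr (tfun s _); exact: Prop_irrelevance.
Qed.

Lemma tilde_sheafP : is_sheaf (Presheaf tilde_res_id tilde_res_comp).
Proof.
move=> U I V hV s cov comp.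
have comp' i j p (hi : oset (V i) p) (hj : oset (V j) p) :
    tfun (s i) hi = tfun (s j) hj.
  have hp : oset (opensI (V i) (V j)) p by [].
  have /(congr1 (fun t : tilde_sec _ => tfun t hp)) /= :=
    comp i j (@opensIl _ _ _) (@opensIr _ _ _).
  by rewrite (Prop_irrelevance (opensIl _) hi) (Prop_irrelevance (opensIr _) hj).
have ex p (hp : oset U p) : exists i, oset (V i) p by have [i _ ?] := cov p hp; exists i.
pose f p (hp : oset U p) := tfun (s (projT1 (cid (ex p hp)))) (projT2 (cid (ex p hp))).
have fP : locally_fraction f.
  move=> p hp; have [i Vip] := ex p hp.
  have [W [Wp WU [m [a hs]]]] := tfunP (s i) Vip.
  exists W; split=> //; first exact: subset_trans WU (hV i).
  exists m, a => q hU Wq; have [ha e] := hs q (WU q Wq) Wq.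
  by exists ha; rewrite -e; exact: comp'.
exists (TildeSec fP); split=> [i|t ht].
  by apply: tilde_ext => p hp /=; exact: comp'.
apply: tilde_ext => p hp /=; rewrite /f; case: cid => i Vip /=.
rewrite -(ht i) /=; congr (tfun t _); exact: Prop_irrelevance.
Qed.

End Tilde.

Section StructureSheaf.
Variable A : comPzRingType.

Definition spec_sec (U : opens (spec A)) : Type := tilde_sec A^o U.
HB.instance Definition _ U := GRing.Zmodule.on (spec_sec U).

Lemma tilde_scaleP (M : lmodType A) (U : opens (spec A)) (r : spec_sec U)
    (s : tilde_sec M U) :
  locally_fraction (fun p (hp : oset U p) => (tfun r hp : locring p) *: tfun s hp).
Proof.
move=> p hp; have [V [Vp VU [c [a hr]]]] := tfunP r hp.
have [W [Wp WU [m [b hs]]]] := tfunP s hp.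
exists (opensI V W); split=> //; first by move=> q [/VU].
exists ((c : A) *: m), (a * b) => q hU [Vq Wq].
have [ha ->] := hr q hU Vq; have [hb ->] := hs q hU Wq.
by exists (specM ha hb); exact: fracZ.
Qed.

Definition tilde_scale (M : lmodType A) (U : opens (spec A)) (r : spec_sec U)
  (s : tilde_sec M U) : tilde_sec M U := TildeSec (tilde_scaleP r s).

Lemma spec_oneP (U : opens (spec A)) :
  @locally_fraction A A^o U (fun p hp => (1 : locring p)).
Proof.
move=> p hp; exists U; split=> //; exists (1 : A), 1 => q hU Uq.
by exists (@spec1 A q).
Qed.

Definition spec_one (U : opens (spec A)) : spec_sec U := TildeSec (@spec_oneP U).

Definition spec_mul (U : opens (spec A)) : spec_sec U -> spec_sec U -> spec_sec U :=
  @tilde_scale A^o U.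

Lemma spec_mulA U : associative (@spec_mul U).
Proof.
move=> r s t; apply: tilde_ext => p hp /=.
exact: (mulrA (tfun r hp : locring p) (tfun s hp) (tfun t hp)).
Qed.

Lemma spec_mulC U : commutative (@spec_mul U).
Proof.
move=> r s; apply: tilde_ext => p hp /=.
exact: (mulrC (tfun r hp : locring p) (tfun s hp)).
Qed.

Lemma spec_mul1 U : left_id (spec_one U) (@spec_mul U).
Proof.
move=> r; apply: tilde_ext => p hp /=.
exact: (mul1r (tfun r hp : locring p)).
Qed.

Lemma spec_mulDl U : left_distributive (@spec_mul U) +%R.
Proof.
move=> r s t; apply: tilde_ext => p hp /=.
exact: (mulrDl (tfun r hp : locring p) (tfun s hp) (tfun t hp)).
Qed.

HB.instance Definition _ U := GRing.Zmodule_isComPzRing.Build (spec_sec U)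
  (@spec_mulA U) (@spec_mulC U) (@spec_mul1 U) (@spec_mulDl U).

Section Module.
Variables (M : lmodType A) (U : opens (spec A)).

Lemma tilde_scaleA (a b : spec_sec U) (v : tilde_sec M U) :
  tilde_scale a (tilde_scale b v) = tilde_scale (a * b) v.
Proof.
apply: tilde_ext => p hp /=.
exact: (scalerA (tfun a hp : locring p) (tfun b hp) (tfun v hp)).
Qed.

Lemma tilde_scale1 : left_id 1 (@tilde_scale M U).
Proof. by move=> v; apply: tilde_ext => p hp /=; rewrite scale1r. Qed.

Lemma tilde_scaleDr : right_distributive (@tilde_scale M U) +%R.
Proof. by move=> a v w; apply: tilde_ext => p hp /=; rewrite scalerDr. Qed.

Lemma tilde_scaleDl (v : tilde_sec M U) :
  {morph (@tilde_scale M U)^~ v : a b / a + b}.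
Proof.
move=> a b; apply: tilde_ext => p hp /=.
exact: (scalerDl (tfun v hp) (tfun a hp : locring p) (tfun b hp)).
Qed.

HB.instance Definition _ := GRing.Zmodule_isLmodule.Build (spec_sec U)
  (tilde_sec M U) tilde_scaleA tilde_scale1 tilde_scaleDr tilde_scaleDl.

End Module.

Section Restriction.
Variables (U V : opens (spec A)) (h : V `<=` U).

Lemma tilde_res_nmod (M : lmodType A) : nmod_morphism (@tilde_res A M U V h).
Proof. by split=> [|s t]; apply: tilde_ext. Qed.

HB.instance Definition _ (M : lmodType A) :=
  GRing.isNmodMorphism.Build (tilde_sec M U) (tilde_sec M V)
    (@tilde_res A M U V h) (tilde_res_nmod M).

Definition spec_res : spec_sec U -> spec_sec V := @tilde_res A A^o U V h.

Lemma spec_res_monoid : monoid_morphism spec_res.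
Proof. by split=> [|s t]; apply: tilde_ext. Qed.

HB.instance Definition _ :=
  GRing.isNmodMorphism.Build (spec_sec U) (spec_sec V)
    spec_res (tilde_res_nmod A^o).
HB.instance Definition _ :=
  GRing.isMonoidMorphism.Build (spec_sec U) (spec_sec V)
    spec_res spec_res_monoid.

End Restriction.

Definition spec_sheaf : ringSheaf (spec A) :=
  @RingSheaf (spec A) (fun U => spec_sec U : comPzRingType)
    (fun U V h => @spec_res U V h : {rmorphism spec_sec U -> spec_sec V})
    (@tilde_res_id A A^o) (@tilde_res_comp A A^o) (@tilde_sheafP A A^o).

Lemma tilde_resZ (M : lmodType A) (U V : opens (spec A)) (h : V `<=` U)
    (a : spec_sec U) (s : tilde_sec M U) :
  tilde_res h (a *: s) = spec_res h a *: tilde_res h s.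
Proof. exact: tilde_ext. Qed.

Definition tilde (M : lmodType A) : modSheaf spec_sheaf :=
  @ModSheaf (spec A) spec_sheaf (fun U => tilde_sec M U : lmodType (spec_sec U))
    (fun U V h => @tilde_res A M U V h : {additive tilde_sec M U -> tilde_sec M V})
    (@tilde_resZ M)
    (@tilde_res_id A M) (@tilde_res_comp A M) (@tilde_sheafP A M).

End StructureSheaf.

Section Preimage.
Variables (X Y : topologicalType) (f : X -> Y).

Definition opens_preimage (hf : continuous f) (V : opens Y) : opens X :=
  Opens (open_comp (fun x _ => hf x) (openP V)).

Lemma opens_preimageS (hf : continuous f) (V W : opens Y) :
  W `<=` V -> opens_preimage hf W `<=` opens_preimage hf V.
Proof. by move=> h x; exact: h. Qed.

End Preimage.

Arguments opens_preimageS {X Y f} hf {V W}.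

(* An isomorphism of ringed spaces from Spec A onto (U, O restricted to U); it
   is automatically an isomorphism of locally ringed spaces. *)
Record affine_chart (X : topologicalType) (O : ringSheaf X) (U : opens X)
    (A : comPzRingType) : Type := AffineChart {
  chart : spec A -> X;
  chart_inj : injective chart;
  chart_range : range chart = U;
  chart_continuous : continuous chart;
  chart_open : forall V : set (spec A), open V -> open (chart @` V);
  chart_ring : forall V : opens X, V `<=` U ->
    {rmorphism O V -> spec_sheaf A (opens_preimage chart_continuous V)};
  chart_ring_bij : forall (V : opens X) (h : V `<=` U), bijective (chart_ring h);
  chart_ring_res : forall (V W : opens X) (hV : V `<=` U) (hW : W `<=` U)
      (h : W `<=` V) (s : O V),
    chart_ring hW (rres O h s) =
    rres (spec_sheaf A) (opens_preimageS chart_continuous h) (chart_ring hV s) }.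

Arguments chart_continuous {X O U A} a.

(* An isomorphism between F restricted to U and the sheaf associated with the
   A-module M, over the isomorphism c. *)
Record tilde_chart (X : topologicalType) (O : ringSheaf X) (F : modSheaf O)
    (U : opens X) (A : comPzRingType) (c : affine_chart O U A) (M : lmodType A)
    : Type := TildeChart {
  chart_mod : forall V : opens X, V `<=` U ->
    {additive F V -> tilde M (opens_preimage (chart_continuous c) V)};
  chart_modZ : forall (V : opens X) (h : V `<=` U) (a : O V) (s : F V),
    chart_mod h (a *: s) = chart_ring c h a *: chart_mod h s;
  chart_mod_bij : forall (V : opens X) (h : V `<=` U), bijective (chart_mod h);
  chart_mod_res : forall (V W : opens X) (hV : V `<=` U) (hW : W `<=` U)
      (h : W `<=` V) (s : F V),
    chart_mod hW (mres F h s) =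
    mres (tilde M) (opens_preimageS (chart_continuous c) h) (chart_mod hV s) }.

Definition affine_open (X : topologicalType) (O : ringSheaf X) (U : opens X) :
  Prop := exists A : comPzRingType, inhabited (affine_chart O U A).

Record scheme : Type := Scheme {
  points :> topologicalType;
  structure_sheaf : ringSheaf points;
  scheme_local : forall x : points, local_ring (rstalk structure_sheaf x);
  scheme_affine : forall x : points, exists U : opens points,
    oset U x /\ affine_open structure_sheaf U }.

Section SchemeNotions.
Variable X : scheme.

Definition locally_coherent : Prop :=
  forall U : opens X, affine_open (structure_sheaf X) U ->
    coherent_ring (structure_sheaf X U).

(* Locally on affine opens, F is the sheaf associated with a module. *)
Definition quasi_coherent (F : modSheaf (structure_sheaf X)) : Prop :=
  forall x : X, exists (U : opens X) (A : comPzRingType)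
      (c : affine_chart (structure_sheaf X) U A) (M : lmodType A),
    oset U x /\ inhabited (tilde_chart F c M).

End SchemeNotions.

(* Main.v *)
Require Import Defs.
From HB Require Import structures.
From mathcomp Require Import all_boot all_order all_algebra.
From mathcomp Require Import generic_quotient.
From mathcomp Require Import all_classical topology.
From mathcomp Require Import ring.
(* so that frac is the fraction of a localization *)
Import Defs.

(** A module A over a commutative ring is absolutely pure exactly when every
    finite linear system P x = a with a in A^m has a solution in A as soon as
    c a = 0 for every row c with c P = 0 (absolutely_pureP). In one direction,
    a system without obstruction has a solution in an extension of A, and purity
    tested on the cokernel of P brings it back to A. In the other, a proof that
    a tensor vanishes over an extension uses finitely many linear relations,
    which form a system over A that is solvable in the extension, hence in A.

    In this form the property is local. If all stalks solve their systems, the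
    denominators of the local solutions of a given system generate the unit
    ideal, so the system has a solution (solves_systems_local). Conversely, let
    a system over a localization of A have no obstruction and clear its
    denominators. Over a coherent ring the rows c with c P = 0 are generated by
    finitely many (coherent_finite_kernel), so a single denominator kills all
    the obstructions over A, and a multiple of the system is solvable there
    (solves_systems_localization).

    Geometry enters in showing that, for F quasi-coherent, U affine and x in U,
    the stalk of F at x is the localization of F(U) at the functions invertible
    at x (localizes_stalk). It follows from the fact that the sections over
    D(f) are the localization of F(U) at the powers of f
    (fractional_quasi_coherent). This holds for the sheaf associated with a
    module on a spectrum (section_fraction), passes to basic open subsets
    (fractional_basic) and can be glued from a finite cover by basic open subsets
    (fractional_glue). Around each of its points, U has an open subset that is
    basic both in U and in an affine open subset where F comes from a module
    (common_basic), and compactness reduces these to finitely many.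

    Affine open subsets cover X, so cond1 implies cond2; the passage to
    stalks gives cond3 from cond2, and the locality of solvability gives cond1
    from cond3. *)

Set Implicit Arguments.
Unset Strict Implicit.
Unset Printing Implicit Defensive.

Import GRing.Theory.
Local Open Scope classical_set_scope.
Local Open Scope quotient_scope.
Local Open Scope ring_scope.

(** * Quotient modules *)

Section Quotient.
Variables (R : comPzRingType) (M : lmodType R).

Record submodule : Type := Submodule {
  sub_carrier :> M -> Prop;
  sub0 : sub_carrier 0;
  subD : forall x y, sub_carrier x -> sub_carrier y -> sub_carrier (x + y);
  subZ : forall a x, sub_carrier x -> sub_carrier (a *: x) }.

Variable N : submodule.

Lemma subN x : N x -> N (- x).
Proof. by move=> Nx; rewrite -scaleN1r; exact: subZ. Qed.

Definition quot_eqv : rel M := fun x y => `[< N (x - y) >].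

Lemma quot_eqv_class : equiv_class_of quot_eqv.
Proof.
split=> [x|x y|y x z].
- by apply/asboolP; rewrite subrr; exact: sub0.
- by apply/asboolP/asboolP => /subN; rewrite opprB.
- move=> /asboolP h /asboolP h'; apply/asboolP.
  by rewrite -(subrKA y); exact: subD.
Qed.

Canonical quot_equiv := EquivRelPack quot_eqv_class.

Definition quot : Type := {eq_quot quot_equiv}.
HB.instance Definition _ := Choice.on quot.

Definition qproj (x : M) : quot := \pi_({eq_quot quot_equiv}) x.
Definition qrep (z : quot) : M := repr (z : {eq_quot quot_equiv}).

Lemma qprojP x y : qproj x = qproj y <-> N (x - y).
Proof.
by split=> [/eqquotP/asboolP//|h]; apply/eqquotP/asboolP.
Qed.

Lemma qrepK z : qproj (qrep z) = z.
Proof. exact: reprK. Qed.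

Lemma qrepP x : N (qrep (qproj x) - x).
Proof. by apply/qprojP; rewrite qrepK. Qed.

Definition quot_add y z := qproj (qrep y + qrep z).
Definition quot_opp z := qproj (- qrep z).
Definition quot_scale a z := qproj (a *: qrep z).

Lemma quot_addE x y : quot_add (qproj x) (qproj y) = qproj (x + y).
Proof. by apply/qprojP; rewrite opprD addrACA; apply: subD; exact: qrepP. Qed.

Lemma quot_oppE x : quot_opp (qproj x) = qproj (- x).
Proof. by apply/qprojP; rewrite -opprD; apply: subN; exact: qrepP. Qed.

Lemma quot_scaleE a x : quot_scale a (qproj x) = qproj (a *: x).
Proof. by apply/qprojP; rewrite -scalerBr; apply: subZ; exact: qrepP. Qed.

Lemma quot_addA : associative quot_add.
Proof.
by move=> x y z; rewrite -(qrepK x) -(qrepK y) -(qrepK z) !quot_addE addrA.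
Qed.

Lemma quot_addC : commutative quot_add.
Proof. by move=> x y; rewrite -(qrepK x) -(qrepK y) !quot_addE addrC. Qed.

Lemma quot_add0 : left_id (qproj 0) quot_add.
Proof. by move=> x; rewrite -(qrepK x) quot_addE add0r. Qed.

Lemma quot_addN : left_inverse (qproj 0) quot_opp quot_add.
Proof. by move=> x; rewrite -(qrepK x) quot_oppE quot_addE addNr. Qed.

HB.instance Definition _ := GRing.isZmodule.Build quot
  quot_addA quot_addC quot_add0 quot_addN.

Lemma quot_scaleA a b z : quot_scale a (quot_scale b z) = quot_scale (a * b) z.
Proof. by rewrite -(qrepK z) !quot_scaleE scalerA. Qed.

Lemma quot_scale1 : left_id 1 quot_scale.
Proof. by move=> z; rewrite -(qrepK z) quot_scaleE scale1r. Qed.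

Lemma quot_scaleDr : right_distributive quot_scale +%R.
Proof.
move=> a x y; rewrite -(qrepK x) -(qrepK y) -[_ + _]/(quot_add _ _) quot_addE.
by rewrite !quot_scaleE -[RHS]/(quot_add _ _) quot_addE scalerDr.
Qed.

Lemma quot_scaleDl z : {morph quot_scale^~ z : a b / a + b}.
Proof.
move=> a b; rewrite -(qrepK z) !quot_scaleE -[RHS]/(quot_add _ _) quot_addE.
by rewrite scalerDl.
Qed.

HB.instance Definition _ := GRing.Zmodule_isLmodule.Build R quot
  quot_scaleA quot_scale1 quot_scaleDr quot_scaleDl.

Lemma qproj_linear : linear qproj.
Proof.
by move=> a x y; rewrite -quot_addE -quot_scaleE.
Qed.

HB.instance Definition _ := GRing.isLinear.Build R M quot *:%R qproj qproj_linear.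

Lemma qproj_eq0 x : qproj x = 0 <-> N x.
Proof. by rewrite -(linear0 qproj) qprojP subr0. Qed.

End Quotient.

Arguments qproj {R M} N x.

(** * Absolute purity and systems of linear equations *)

Section Systems.
Variables (R : comPzRingType) (A : lmodType R).

Definition compatible m n (P : 'I_m -> 'I_n -> R) (a : 'I_m -> A) : Prop :=
  forall c : 'I_m -> R, (forall j, \sum_i c i * P i j = 0) ->
    \sum_i c i *: a i = 0.

Definition solves_systems : Prop :=
  forall m n (P : 'I_m -> 'I_n -> R) (a : 'I_m -> A), compatible P a ->
    exists x : 'I_n -> A, forall i, \sum_j P i j *: x j = a i.

End Systems.

Section TensorLemmas.
Variables (R : comPzRingType) (T N : lmodType R).

Lemma tensDl (t t' : T) (n : N) : tens (t + t') n = tens t n + tens t' n.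
Proof.
transitivity (tens_sum [:: (t, n); (t', n)]).
  by apply/tens_sumP; exact: tens_addl.
by rewrite tens_sumE big_cons big_seq1.
Qed.

Lemma tensDr (t : T) (n n' : N) : tens t (n + n') = tens t n + tens t n'.
Proof.
transitivity (tens_sum [:: (t, n); (t, n')]).
  by apply/tens_sumP; exact: tens_addr.
by rewrite tens_sumE big_cons big_seq1.
Qed.

Lemma tens0l (n : N) : tens (0 : T) n = 0.
Proof. by apply/tens_sumP; exact: tens_0l. Qed.

Lemma tens0r (t : T) : tens t (0 : N) = 0.
Proof. by apply/tens_sumP; exact: tens_0r. Qed.

Lemma tensZ r (t : T) (n : N) : tens (r *: t) n = tens t (r *: n).
Proof. by apply/tens_sumP; exact: tens_scale. Qed.

Lemma tens_suml I (s : seq I) (f : I -> T) (n : N) :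
  tens (\sum_(i <- s) f i) n = \sum_(i <- s) tens (f i) n.
Proof.
by elim: s => [|x s IH]; rewrite ?big_nil ?tens0l// !big_cons tensDl IH.
Qed.

Lemma tens_sumr I (s : seq I) (t : T) (f : I -> N) :
  tens t (\sum_(i <- s) f i) = \sum_(i <- s) tens t (f i).
Proof.
by elim: s => [|x s IH]; rewrite ?big_nil ?tens0r// !big_cons tensDr IH.
Qed.

(** Moving the coefficients across makes the sum vanish as soon as the columns
    of P are relations between the t_i. *)
Lemma tens_sum_system m n (P : 'I_m -> 'I_n -> R) (t : 'I_m -> T) (x : 'I_n -> N) :
  \sum_i tens (t i) (\sum_j P i j *: x j) =
  \sum_j tens (\sum_i P i j *: t i) (x j).
Proof.
under eq_bigr do rewrite tens_sumr.
rewrite exchange_big; apply: eq_bigr => j _; rewrite tens_suml.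
by apply: eq_bigr => i _; rewrite tensZ.
Qed.

End TensorLemmas.

Section PureSolves.
Variables (R : comPzRingType) (A : lmodType R).
Variables (m n : nat) (P : 'I_m -> 'I_n -> R) (a : 'I_m -> A).

Definition forced (z : A * 'rV[R]_n) : Prop :=
  exists c : 'I_m -> R, z.1 = \sum_i c i *: a i /\
    forall j, z.2 0 j = - \sum_i c i * P i j.

Lemma forced0 : forced 0.
Proof.
exists (fun=> 0); split=> [|j]; rewrite ?mxE big1 ?oppr0// => i _.
  exact: scale0r.
exact: mul0r.
Qed.

Lemma forcedD y z : forced y -> forced z -> forced (y + z).
Proof.
move=> [c [c1 c2]] [d [d1 d2]]; exists (fun i => c i + d i); split=> [|j].
  by rewrite /= c1 d1 -big_split; apply: eq_bigr => i _; rewrite scalerDl.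
rewrite mxE c2 d2 -opprD -big_split; congr (- _).
by apply: eq_bigr => i _; rewrite mulrDl.
Qed.

Lemma forcedZ r z : forced z -> forced (r *: z).
Proof.
move=> [c [c1 c2]]; exists (fun i => r * c i); split=> [|j].
  by rewrite /= c1 scaler_sumr; apply: eq_bigr => i _; rewrite scalerA.
rewrite mxE c2 mulrN mulr_sumr; congr (- _).
by apply: eq_bigr => i _; rewrite mulrA.
Qed.

(** The universal extension of A in which the system P x = a has a solution. *)
Definition extension : lmodType R := quot (Submodule forced0 forcedD forcedZ).

Definition extend (x : A) : extension := qproj _ (x, 0 : 'rV[R]_n).

Lemma extend_linear : linear extend.
Proof.
move=> r x y; rewrite /extend -linearP; congr (qproj _).
by rewrite [RHS]surjective_pairing /= scaler0 addr0.
Qed.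

HB.instance Definition _ :=
  GRing.isLinear.Build R A extension *:%R extend extend_linear.

Lemma extend_inj : compatible P a -> injective extend.
Proof.
move=> comp x y /qprojP[c [c1 c2]]; apply: subr0_eq; rewrite [LHS]c1.
apply: comp => j; apply: oppr_inj; rewrite -c2 oppr0 /=.
by rewrite subrr mxE.
Qed.

Definition unknown (j : 'I_n) : extension := qproj _ (0 : A, delta_mx 0 j).

Lemma extend_solved i : extend (a i) = \sum_j P i j *: unknown j.
Proof.
have -> : \sum_j P i j *: unknown j =
    qproj _ (0, \row_j P i j) :> extension.
  under eq_bigr do rewrite -linearZ.
  rewrite -linear_sum; congr (qproj _).
  rewrite [LHS]surjective_pairing; congr pair.
    by rewrite (raddf_sum fst) big1// => j _ /=; rewrite scaler0.
  rewrite (raddf_sum snd) [RHS]row_sum_delta; apply: eq_bigr => j _ /=.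
  by rewrite mxE.
apply/qprojP; exists (fun k => (k == i)%:R); split=> [|j] /=.
  rewrite subr0 (bigD1 i)//= eqxx scale1r big1 ?addr0// => k /negPf ->.
  exact: scale0r.
rewrite !mxE sub0r (bigD1 i)//= eqxx mul1r big1 ?addr0// => k /negPf ->.
exact: mul0r.
Qed.

Definition column_combination (t : 'rV[R]_m) : Prop :=
  exists x : 'I_n -> R, forall i, t 0 i = \sum_j P i j * x j.

Lemma column_combination0 : column_combination 0.
Proof. by exists (fun=> 0) => i; rewrite mxE big1// => j _; rewrite mulr0. Qed.

Lemma column_combinationD s t :
  column_combination s -> column_combination t -> column_combination (s + t).
Proof.
move=> [x hx] [y hy]; exists (fun j => x j + y j) => i.
by rewrite mxE hx hy -big_split; apply: eq_bigr => j _; rewrite mulrDr.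
Qed.

Lemma column_combinationZ r t :
  column_combination t -> column_combination (r *: t).
Proof.
move=> [x hx]; exists (fun j => r * x j) => i.
by rewrite mxE hx mulr_sumr; apply: eq_bigr => j _; rewrite mulrCA.
Qed.

(** The cokernel of P: tensoring it with A gives A^m modulo P A^n. *)
Definition columns := Submodule column_combination0 column_combinationD
  column_combinationZ.
Definition cokernel : lmodType R := quot columns.

Lemma qrep_columns (t : cokernel) (u : 'rV[R]_m) (b : A) :
  columns (qrep t - u) -> exists x : 'I_n -> A, forall i,
    qrep t 0 i *: b = u 0 i *: b + \sum_j P i j *: x j.
Proof.
move=> [x hx]; exists (fun j => x j *: b) => i.
have /eqP := hx i; rewrite 2!mxE subr_eq => /eqP ->.
rewrite scalerDl addrC scaler_suml; congr (_ + _).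
by apply: eq_bigr => j _; rewrite scalerA.
Qed.

Let sum_scaler0 i : \sum_(j < n) P i j *: (0 : A) = 0.
Proof. by rewrite big1// => j _; rewrite scaler0. Qed.

(** The isomorphism of cokernel (x) A with A^m / P A^n, in the form needed
    here: equal tensors have coordinate vectors that differ by some P x. *)
Lemma tens_rel_cokernel (s s' : seq (cokernel * A)) :
  tens_rel s s' -> exists x : 'I_n -> A, forall i,
    \sum_(y <- s) qrep y.1 0 i *: y.2 =
    \sum_(y <- s') qrep y.1 0 i *: y.2 + \sum_j P i j *: x j.
Proof.
elim=> {s s'}.
- by move=> s; exists (fun=> 0) => i; rewrite sum_scaler0 addr0.
- move=> s t _ [x hx]; exists (fun j => - x j) => i; rewrite hx -addrA -big_split.
  by rewrite [X in _ + X]big1 ?addr0// => j _; rewrite /= scalerN subrr.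
- move=> s t u _ [x hx] _ [y hy]; exists (fun j => y j + x j) => i.
  rewrite hx hy -addrA -big_split; congr (_ + _).
  by apply: eq_bigr => j _; rewrite scalerDr.
- move=> s s' t t' _ [x hx] _ [y hy]; exists (fun j => x j + y j) => i.
  rewrite !big_cat /= hx hy addrACA -big_split; congr (_ + _).
  by apply: eq_bigr => j _; rewrite scalerDr.
- move=> s t; exists (fun=> 0) => i.
  rewrite sum_scaler0 addr0.
  by rewrite !big_cat /= addrC.
- move=> b; have [|x hx] := @qrep_columns 0 0 b.
    by apply/qprojP; rewrite qrepK linear0.
  exists x => i; rewrite big_seq1 big_nil hx mxE scale0r //.
- move=> t; exists (fun=> 0) => i.
  rewrite sum_scaler0 addr0.
  by rewrite big_seq1 big_nil scaler0.
- move=> t t' b; have [|x hx] := @qrep_columns (t + t') (qrep t + qrep t') b.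
    by apply/qprojP; rewrite linearD /= !qrepK.
  by exists x => i; rewrite big_seq1 big_cons big_seq1 hx mxE scalerDl.
- move=> t b b'; exists (fun=> 0) => i.
  rewrite sum_scaler0 addr0.
  by rewrite big_seq1 big_cons big_seq1 scalerDr.
- move=> r t b; have [|x hx] := @qrep_columns (r *: t) (r *: qrep t) b.
    by apply/qprojP; rewrite linearZ /= !qrepK.
  by exists x => i; rewrite !big_seq1 hx mxE scalerA mulrC.
Qed.

(** The element sum_i e_i (x) a_i dies in the tensor product with the extension,
    by the linear relations that define the cokernel; purity makes it vanish
    already over A, which says that a is P x for some x. *)
Lemma absolutely_pure_solution :
  absolutely_pure A -> compatible P a ->
  exists x : 'I_n -> A, forall i, \sum_j P i j *: x j = a i.
Proof.
move=> pA comp.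
pose e (i : 'I_m) : cokernel := qproj columns (delta_mx 0 i).
pose s := [seq (e i, a i) | i <- index_enum 'I_m].
have : tensor_map (T := cokernel) extend (tens_sum s) =
       tensor_map (T := cokernel) extend (tens_sum [::]).
  rewrite !tensor_mapE !tens_sumE !big_map big_nil /=.
  under eq_bigr do rewrite extend_solved.
  rewrite tens_sum_system big1// => j _.
  suff -> : \sum_i P i j *: e i = 0 by exact: tens0l.
  under eq_bigr do rewrite -linearZ.
  rewrite -linear_sum; apply/qproj_eq0.
  exists (fun k => (k == j)%:R) => i.
  rewrite summxE (bigD1 i)//= !mxE !eqxx mulr1 big1 ?addr0; last first.
    by move=> k /negPf ki; rewrite !mxE eq_sym ki andbF mulr0.
  rewrite (bigD1 j)//= eqxx mulr1 big1 ?addr0// => k /negPf ->.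
  by rewrite mulr0.
move=> /(pA _ _ (extend_inj comp)) /tens_sumP /tens_sym /tens_rel_cokernel[x hx].
have /all_sig[y hy] (i : 'I_m) : {y : 'I_n -> A | forall k,
    qrep (e i) 0 k *: a i = (delta_mx 0 i : 'rV[R]_m) 0 k *: a i + \sum_j P k j *: y j}.
  by apply: cid; apply: qrep_columns; exact: qrepP.
exists (fun j => - (x j + \sum_k y k j)) => i.
have := hx i; rewrite big_nil big_map /=.
rewrite (eq_bigr _ (fun k _ => hy k i)) big_split /=.
rewrite (bigD1 i)//= mxE !eqxx scale1r big1 ?addr0; last first.
  by move=> k /negPf ki; rewrite mxE eq_sym ki andbF scale0r.
move=> /eqP; rewrite eq_sym -addrA addr_eq0 => /eqP ->.
under eq_bigr do rewrite scalerN scalerDr scaler_sumr.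
rewrite sumrN big_split /= addrC; congr (- (_ + _)).
exact: exchange_big.
Qed.

End PureSolves.

Section SolvesPure.
Variables (R : comPzRingType) (T N A : lmodType R).

Definition preserves (r : N -> A) (q : seq (R * N)) : Prop :=
  \sum_(z <- q) z.1 *: r z.2 = 0.

Definition relation (q : seq (R * N)) : Prop := \sum_(z <- q) z.1 *: z.2 = 0.

(** A derivation that two tensors over N are equal mentions only finitely many
    elements of N and uses only finitely many linear relations between them,
    so it is carried over by any map, linear or not, that preserves those. *)
Lemma tens_rel_finite (s t : seq (T * N)) : tens_rel s t ->
  exists Q : seq (seq (R * N)), {in Q, forall q, relation q} /\
    forall r : N -> A, {in Q, forall q, preserves r q} ->
    tens_rel (map (fun z => (z.1, r z.2)) s) (map (fun z => (z.1, r z.2)) t).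
Proof.
elim=> {s t}.
- by move=> s; exists [::]; split=> // r _; exact: tens_refl.
- by move=> s t _ [Q [Q0 h]]; exists Q; split=> // r /h; exact: tens_sym.
- move=> s t u _ [Q [Q0 h]] _ [Q' [Q'0 h']]; exists (Q ++ Q'); split.
    by move=> q; rewrite mem_cat => /orP[/Q0|/Q'0].
  move=> r hr; apply: tens_trans (h' r _).
    by apply: h => q qQ; apply: hr; rewrite mem_cat qQ.
  by move=> q qQ; apply: hr; rewrite mem_cat qQ orbT.
- move=> s s' t t' _ [Q [Q0 h]] _ [Q' [Q'0 h']]; exists (Q ++ Q'); split.
    by move=> q; rewrite mem_cat => /orP[/Q0|/Q'0].
  move=> r hr; rewrite !map_cat; apply: tens_cat.
    by apply: h => q qQ; apply: hr; rewrite mem_cat qQ.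
  by apply: h' => q qQ; apply: hr; rewrite mem_cat qQ orbT.
- by move=> s t; exists [::]; split=> // r _; rewrite !map_cat; exact: tens_catC.
- by move=> n; exists [::]; split=> // r _; exact: tens_0l.
- move=> t; exists [:: [:: (1, 0)]]; split=> [q|r /(_ _ (mem_head _ _))].
    by rewrite inE => /eqP ->; rewrite /relation big_seq1 scaler0.
  by rewrite /preserves big_seq1 /= scale1r => ->; exact: tens_0r.
- by move=> t t' n; exists [::]; split=> // r _; exact: tens_addl.
- move=> t n n'; exists [:: [:: (1, n); (1, n'); (-1, n + n')]]; split=> [q|].
    rewrite inE => /eqP ->; rewrite /relation !big_cons big_nil /=.
    by rewrite addr0 !scale1r scaleN1r addrA subrr.
  move=> r /(_ _ (mem_head _ _)); rewrite /preserves !big_cons big_nil /=.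
  rewrite addr0 !scale1r scaleN1r addrA => /subr0_eq <-; exact: tens_addr.
- move=> r t n; exists [:: [:: (r, n); (-1, r *: n)]]; split=> [q|].
    rewrite inE => /eqP ->; rewrite /relation !big_cons big_nil /=.
    by rewrite addr0 scaleN1r subrr.
  move=> f /(_ _ (mem_head _ _)); rewrite /preserves !big_cons big_nil /=.
  rewrite addr0 scaleN1r => /subr0_eq <-; exact: tens_scale.
Qed.

(** Preserving finitely many relations of N, together with prescribed values on
    finitely many elements of A, is a finite linear system over A. It is
    compatible because it has a solution in N. *)
Lemma finite_retraction (i : {linear A -> N}) (Q : seq (seq (R * N))) (s : seq A) :
  solves_systems A -> injective i -> {in Q, forall q, relation q} ->
  exists r : N -> A, {in Q, forall q, preserves r q} /\ {in s, forall b, r (i b) = b}.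
Proof.
move=> sol inj rel.
pose Z := undup ([seq z.2 | z <- flatten Q] ++ map i s).
have memZ q z : q \in Q -> z \in q -> z.2 \in Z.
  move=> qQ zq; rewrite mem_undup mem_cat; apply/orP; left; apply/mapP.
  by exists z => //; apply/flattenP; exists q.
have memZs b : b \in s -> i b \in Z.
  by move=> bs; rewrite mem_undup mem_cat map_f ?orbT.
pose E := Q ++ [seq [:: (1, i b)] | b <- s].
pose w := nseq (size Q) (0 : A) ++ s.
have sizeE : size E = (size Q + size s)%N by rewrite size_cat size_map.
pose coef (q : seq (R * N)) (x : N) : R := \sum_(z <- q | z.2 == x) z.1.
have sumE (B : lmodType R) (f : N -> B) (q : seq (R * N)) :
    {in q, forall z, z.2 \in Z} ->
    \sum_(z <- q) z.1 *: f z.2 = \sum_(j < size Z) coef q Z`_j *: f Z`_j.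
  move=> hq; rewrite -(big_mkord xpredT (fun j => coef q Z`_j *: f Z`_j)).
  rewrite -(big_nth 0 xpredT (fun x => coef q x *: f x)) /coef.
  under [RHS]eq_bigr do rewrite scaler_suml.
  rewrite (exchange_big_dep xpredT)//= big_seq [RHS]big_seq.
  apply: eq_bigr => z zq; rewrite -big_filter.
  suff -> : [seq x <- Z | z.2 == x] = [:: z.2] by rewrite big_seq1.
  rewrite (eq_filter (a2 := pred1 z.2)); last by move=> x; rewrite /= eq_sym.
  by rewrite filter_pred1_uniq ?undup_uniq ?hq.
have Emem q : q \in E -> {in q, forall z, z.2 \in Z}.
  rewrite mem_cat => /orP[qQ z|/mapP[b bs ->] z]; first exact: memZ.
  by rewrite inE => /eqP -> /=; exact: memZs.
pose P (k : 'I_(size E)) (j : 'I_(size Z)) := coef (nth [::] E k) Z`_j.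
pose a (k : 'I_(size E)) : A := w`_k.
have solN k : \sum_j P k j *: Z`_j = i (a k).
  rewrite /P -(sumE N id) => [|z]; last by apply: Emem; exact: mem_nth.
  rewrite /a /E /w !nth_cat size_nseq nth_nseq.
  case: ltnP => kQ; first by rewrite raddf0; apply: rel; exact: mem_nth.
  have ks : (k - size Q < size s)%N by rewrite ltn_subLR// -sizeE.
  by rewrite (nth_map 0)// big_seq1 scale1r.
have [|x hx] := sol _ _ P a.
  move=> c hc; apply: inj; rewrite raddf0 linear_sum.
  under eq_bigr do rewrite linearZ /= -solN scaler_sumr.
  rewrite exchange_big big1// => j _ /=.
  under eq_bigr do rewrite scalerA.
  by rewrite -scaler_suml hc scale0r.
pose r (y : N) : A := if insub (index y Z) is Some j then x j else 0.
have rZ (j : 'I_(size Z)) : r Z`_j = x j.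
  by rewrite /r index_uniq ?undup_uniq ?ltn_ord// valK.
have hr (k : 'I_(size E)) : \sum_(z <- nth [::] E k) z.1 *: r z.2 = a k.
  rewrite (sumE A r) => [|z]; last by apply: Emem; exact: mem_nth.
  by rewrite -hx; apply: eq_bigr => j _; rewrite rZ.
exists r; split=> [q qQ|b bs].
  have kE : (index q Q < size E)%N.
    by rewrite sizeE ltn_addr// index_mem.
  have := hr (Ordinal kE); rewrite /preserves /a /= !nth_cat size_nseq.
  by rewrite index_mem qQ nth_index// nth_nseq index_mem qQ.
have kE : (size Q + index b s < size E)%N by rewrite sizeE ltn_add2l index_mem.
have := hr (Ordinal kE); rewrite /a /= !nth_cat size_nseq.
rewrite ltnNge leq_addr /= addKn (nth_map 0) ?index_mem// nth_index// big_seq1.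
by rewrite scale1r.
Qed.

End SolvesPure.

(** A condition on all extensions of A and all tensor products becomes one on
    finite data, to which localization can be applied. *)
Theorem absolutely_pureP (R : comPzRingType) (A : lmodType R) :
  absolutely_pure A <-> solves_systems A.
Proof.
split=> [pA m n P a|sol N i inj T x y]; first exact: absolutely_pure_solution.
have [s ->] := tens_sum_ex x; have [t ->] := tens_sum_ex y.
rewrite !tensor_mapE => /tens_sumP/(@tens_rel_finite _ _ _ A)[Q [Q0 h]].
have [r [rQ rs]] := @finite_retraction _ _ _ i Q (map snd (s ++ t)) sol inj Q0.
apply/tens_sumP; have := h r rQ.
have id_on (u : seq (T * A)) : {subset u <= s ++ t} ->
    map (fun z => (z.1, r z.2)) (map (fun z => (z.1, i z.2)) u) = u.
  move=> us; rewrite -map_comp -[RHS]map_id; apply/eq_in_map => z zu /=.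
  by rewrite rs -?surjective_pairing//; apply: map_f; exact: us.
by rewrite !id_on// => z; rewrite mem_cat => ->; rewrite ?orbT.
Qed.

(** * Syzygies over a coherent ring *)

Section Coherence.
Variable R : comPzRingType.

Definition finite_kernel m n (P : 'I_m -> 'I_n -> R) : Prop :=
  exists (K : finType) (g : K -> 'I_m -> R),
    (forall k j, \sum_i g k i * P i j = 0) /\
    forall c, (forall j, \sum_i c i * P i j = 0) ->
      exists d : K -> R, forall i, c i = \sum_k d k * g k i.

(** A finite presentation f : R^n -> I of the ideal I = (v_0, ..., v_{m-1})
    gives generators for the syzygies of the given v, as in the lemma of
    Schanuel: lift the v_i to R^n, express the f(e_j) in the v_i; a syzygy of v
    is the image of a relation in ker f, up to the differences between the basis
    vectors of R^m and their images under both changes of generators. *)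
Lemma coherent_syzygies m (v : 'I_m -> R) : coherent_ring R ->
  exists (K : finType) (g : K -> 'I_m -> R),
    (forall k, \sum_i g k i * v i = 0) /\
    forall c, \sum_i c i * v i = 0 ->
      exists d : K -> R, forall i, c i = \sum_k d k * g k i.
Proof.
move=> coh; have fgI : finitely_generated (span_of (v : 'I_m -> R^o)) by exists m, v.
have [n [f [fI [q [r kerf]]]]] := coh _ fgI.
have /choice[w hw] i : exists x : 'rV[R]_n, f x = v i.
  suff : range f (v i) by case=> x _ <-; exists x.
  rewrite fI; exists (fun k => (k == i)%:R).
  rewrite (bigD1 i)//= eqxx scale1r big1 ?addr0// => k /negPf ->.
  exact: scale0r.
have /choice[u hu] j : exists c : 'I_m -> R, f (delta_mx 0 j) = \sum_i c i * v i.
  suff : span_of (v : 'I_m -> R^o) (f (delta_mx 0 j)) by case=> c ->; exists c.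
  by rewrite -fI; exists (delta_mx 0 j).
pose U (x : 'rV[R]_n) i := \sum_j x 0 j * u j i.
have fU x : f x = \sum_i U x i * v i.
  rewrite [x in LHS]row_sum_delta linear_sum /U.
  under eq_bigr do rewrite linearZ hu.
  under [RHS]eq_bigr do rewrite mulr_suml.
  rewrite [RHS]exchange_big; apply: eq_bigr => j _; rewrite -[LHS]/(_ * _) mulr_sumr.
  by apply: eq_bigr => i _; rewrite mulrA.
have U_sum I (s : seq I) (a : I -> R) (x : I -> 'rV[R]_n) i :
    U (\sum_(k <- s) a k *: x k) i = \sum_(k <- s) a k * U (x k) i.
  rewrite /U; under [RHS]eq_bigr do rewrite mulr_sumr.
  rewrite [RHS]exchange_big; apply: eq_bigr => j _; rewrite summxE mulr_suml.
  by apply: eq_bigr => k _; rewrite mxE mulrA.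
have sum_delta (a : 'I_m -> R) i : \sum_k a k * (k == i)%:R = a i.
  rewrite (bigD1 i)//= eqxx mulr1 big1 ?addr0// => k /negPf ->.
  exact: mulr0.
exists ('I_m + 'I_q)%type, (fun k i => match k with
  | inl k => (k == i)%:R - U (w k) i | inr l => U (r l) i end); split.
  case=> [k|l].
    under eq_bigr do rewrite mulrBl.
    rewrite sumrB -fU hw; under eq_bigr do rewrite mulrC eq_sym.
    by rewrite sum_delta subrr.
  rewrite -fU; suff : [set x | f x = 0] (r l) by [].
  rewrite kerf; exists (fun k => (k == l)%:R).
  rewrite (bigD1 l)//= eqxx scale1r big1 ?addr0// => k /negPf ->.
  exact: scale0r.
move=> c hc; pose x := \sum_i c i *: w i.
have [d hd] : span_of r x.
  rewrite -kerf /= linear_sum -[RHS]hc; apply: eq_bigr => i _.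
  by rewrite linearZ /= hw.
exists (fun k => match k with inl k => c k | inr l => d l end) => i.
rewrite big_sumType /= -U_sum -hd U_sum -big_split /= -[LHS]sum_delta.
by apply: eq_bigr => k _; rewrite -mulrDr subrK.
Qed.

(** The kernel of a matrix is cut out one column at a time: inside the kernel
    of the first columns, with generators g, the next one cuts out the
    combinations of the g by syzygies of the values that it takes on them. *)
Lemma coherent_finite_kernel m n (P : 'I_m -> 'I_n -> R) :
  coherent_ring R -> finite_kernel P.
Proof.
move=> coh.
suff [K [g [g0 gK]]] : exists (K : finType) (g : K -> 'I_m -> R),
    (forall k j, j \in enum 'I_n -> \sum_i g k i * P i j = 0) /\
    forall c, (forall j, j \in enum 'I_n -> \sum_i c i * P i j = 0) ->
      exists d : K -> R, forall i, c i = \sum_k d k * g k i.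
  exists K, g; split=> [k j|c hc]; first by rewrite g0// mem_enum.
  by apply: gK => j _; exact: hc.
elim: (enum 'I_n) => [|j0 s [K [g [g0 gK]]]].
  exists 'I_m, (fun k i => (k == i)%:R); split=> // c _; exists c => i.
  rewrite (bigD1 i)//= eqxx mulr1 big1 ?addr0// => k /negPf ->.
  by rewrite mulr0.
pose y (k : 'I_#|K|) := \sum_i g (enum_val k) i * P i j0.
have [L [h [h0 hL]]] := coherent_syzygies y coh.
have sumy (c : 'I_#|K| -> R) :
    \sum_i (\sum_k c k * g (enum_val k) i) * P i j0 = \sum_k c k * y k.
  under eq_bigr do rewrite mulr_suml.
  rewrite exchange_big; apply: eq_bigr => k _; rewrite mulr_sumr.
  by apply: eq_bigr => i _; rewrite mulrA.
exists L, (fun l i => \sum_k h l k * g (enum_val k) i); split.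
  move=> l j; rewrite inE => /orP[/eqP ->|js]; first by rewrite sumy h0.
  under eq_bigr do rewrite mulr_suml.
  rewrite exchange_big big1// => k _.
  under eq_bigr do rewrite -mulrA.
  by rewrite -mulr_sumr g0// mulr0.
move=> c hc; have [j js|d hd] := gK c.
  by apply: hc; rewrite inE js orbT.
have cE i : c i = \sum_(k < #|K|) d (enum_val k) * g (enum_val k) i.
  rewrite hd (reindex (@enum_val K xpredT)) //.
  by apply: onW_bij; exact: enum_val_bij.
have [|e he] := hL (fun k => d (enum_val k)).
  rewrite -sumy -[RHS](hc j0) ?mem_head//.
  by apply: eq_bigr => i _; rewrite -cE.
exists e => i; rewrite cE.
under eq_bigr do rewrite he mulr_suml.
rewrite exchange_big; apply: eq_bigr => l _; rewrite mulr_sumr.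
by apply: eq_bigr => k _; rewrite mulrA.
Qed.

End Coherence.

(** * Absolute purity and localization *)

Section Localizes.
Variables (R R' : comPzRingType) (phi : {rmorphism R -> R'}).

Definition inverted (s : R) : Prop := exists v, phi s * v = 1.

Lemma inverted1 : inverted 1.
Proof. by exists 1; rewrite mulr1 rmorph1. Qed.

Lemma invertedM s t : inverted s -> inverted t -> inverted (s * t).
Proof.
by move=> [v hv] [w hw]; exists (v * w); rewrite rmorphM mulrACA hv hw mulr1.
Qed.

Lemma inverted_prod (I : finType) (s : I -> R) :
  (forall i, inverted (s i)) -> inverted (\prod_i s i).
Proof.
by move=> hs; elim/big_ind: _ => //; [exact: inverted1|exact: invertedM].
Qed.

Lemma invertedI (M' : lmodType R') s : inverted s -> injective (fun z : M' => phi s *: z).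
Proof.
move=> [v hv] x y /(congr1 (fun z => v *: z)).
by rewrite !scalerA mulrC hv !scale1r.
Qed.

(** Up to isomorphism, M' is the localization of M at the elements that phi
    makes invertible, and psi the canonical map: the two last conditions give
    the elements of M' as fractions and the fractions that are zero. *)
Record localizes (M : lmodType R) (M' : lmodType R') (psi : M -> M') : Prop :=
  Localizes {
    localizesD : {morph psi : x y / x + y};
    localizesZ : forall a x, psi (a *: x) = phi a *: psi x;
    localizes_frac : forall z, exists s x, inverted s /\ phi s *: z = psi x;
    localizes_eq0 : forall x, psi x = 0 -> exists s, inverted s /\ s *: x = 0 }.

Section Module.
Variables (M : lmodType R) (M' : lmodType R') (psi : M -> M').
Hypothesis loc : localizes psi.

Lemma localizes0 : psi 0 = 0.
Proof. by apply: (addrI (psi 0)); rewrite -(localizesD loc) !addr0. Qed.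

Lemma localizes_sum (I : finType) (f : I -> M) :
  psi (\sum_i f i) = \sum_i psi (f i).
Proof. exact: (big_morph psi (localizesD loc) localizes0). Qed.

Lemma common_denominator (I : finType) (z : I -> M') :
  exists s x, inverted s /\ forall i, phi s *: z i = psi (x i).
Proof.
have /choice[s /choice[x h]] i := localizes_frac loc (z i).
exists (\prod_i s i), (fun i => (\prod_(j | j != i) s j) *: x i); split.
  by apply: inverted_prod => i; case: (h i).
move=> i; rewrite (bigD1 i)//= localizesZ// -(h i).2 scalerA rmorphM.
by rewrite mulrC.
Qed.

Lemma common_annihilator (I : finType) (x : I -> M) :
  (forall i, psi (x i) = 0) -> exists s, inverted s /\ forall i, s *: x i = 0.
Proof.
move=> hx; have /choice[s h] i := localizes_eq0 loc (hx i).
exists (\prod_i s i); split; first by apply: inverted_prod => i; case: (h i).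
move=> i; rewrite (bigD1 i)//= mulrC -scalerA (h i).2; exact: scaler0.
Qed.

End Module.

(** Clear denominators in the system. The obstructions to solving it over R are
    generated by finitely many, each of which vanishes after localization, so
    that a multiple of the system is free of obstructions. *)
Lemma solves_systems_localization (M : lmodType R) (M' : lmodType R')
    (psi : M -> M') :
  localizes (phi : R^o -> R'^o) -> localizes psi ->
  (forall m n (P : 'I_m -> 'I_n -> R), finite_kernel P) ->
  solves_systems M -> solves_systems M'.
Proof.
move=> locR loc fin sol m n P' a' comp.
have [s1 [P [inv1 hP]]] :=
  common_denominator locR (fun k : 'I_m * 'I_n => P' k.1 k.2 : R'^o).
have [s2 [a [inv2 ha]]] := common_denominator loc a'.
have {}hP i j : phi s1 * P' i j = phi (P (i, j)) := hP (i, j).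
have [K [g [g0 gK]]] := fin m n (fun i j => P (i, j)).
have [k|u [invu hu]] := common_annihilator loc (x := fun k => \sum_i g k i *: a i).
  rewrite (localizes_sum loc); under eq_bigr do rewrite (localizesZ loc) -ha.
  under eq_bigr do rewrite scalerA mulrC -scalerA.
  rewrite -scaler_sumr comp ?scaler0// => j.
  apply: (@invertedI R'^o s1 inv1); rewrite scaler0 -[LHS]/(_ * _) mulr_sumr.
  rewrite -[RHS](rmorph0 phi) -[in RHS](g0 k j) rmorph_sum.
  by apply: eq_bigr => i _; rewrite rmorphM -hP mulrCA.
have [|x hx] := sol _ _ (fun i j => P (i, j)) (fun i => u *: a i).
  move=> c /gK[d hd].
  under eq_bigr do rewrite hd scaler_suml.
  rewrite exchange_big big1// => k _ /=.
  transitivity (d k *: (u *: \sum_i g k i *: a i)); last by rewrite hu scaler0.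
  rewrite !scaler_sumr; apply: eq_bigr => i _.
  by rewrite !scalerA; congr (_ *: _); ring.
have [v hv] := invertedM inv2 invu.
exists (fun j => (v * phi s1) *: psi (x j)) => i.
transitivity (v *: \sum_j phi (P (i, j)) *: psi (x j)).
  rewrite scaler_sumr; apply: eq_bigr => j _.
  by rewrite -hP !scalerA; congr (_ *: _); ring.
have -> : \sum_j phi (P (i, j)) *: psi (x j) = phi (s2 * u) *: a' i.
  rewrite mulrC rmorphM -scalerA ha -(localizesZ loc) -hx (localizes_sum loc).
  by apply: eq_bigr => j _; rewrite (localizesZ loc).
by rewrite scalerA mulrC hv scale1r.
Qed.

End Localizes.

(** The denominators of the local solutions of a system form an ideal, as
    s a = P x and t a = P y give (r s + t) a = P (r x + y). *)
Lemma solves_systems_local (R : comPzRingType) (M : lmodType R) (I : Type)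
    (R' : I -> comPzRingType) (M' : forall i, lmodType (R' i))
    (phi : forall i, {rmorphism R -> R' i}) (psi : forall i, M -> M' i) :
  (forall i, localizes (phi i) (phi i : R^o -> (R' i)^o)) ->
  (forall i, localizes (phi i) (psi i)) ->
  (forall J : set R, ideal J -> (forall i, exists2 s, J s & inverted (phi i) s) ->
     J 1) ->
  (forall i, solves_systems (M' i)) -> solves_systems M.
Proof.
move=> locR loc cover sol m n P a comp.
pose J : set R :=
  [set s | exists x : 'I_n -> M, forall k, \sum_j P k j *: x j = s *: a k].
suff [x hx] : J 1 by exists x => k; rewrite hx scale1r.
apply: cover.
  split=> [|s t [x hx] [y hy]|r s [x hx]].
  - exists (fun=> 0) => k; rewrite scale0r big1// => j _; exact: scaler0.
  - exists (fun j => x j + y j) => k; rewrite scalerDl -hx -hy -big_split.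
    by apply: eq_bigr => j _; rewrite scalerDr.
  - exists (fun j => r *: x j) => k; rewrite -scalerA -hx scaler_sumr.
    by apply: eq_bigr => j _; rewrite !scalerA mulrC.
move=> i; have [|x' hx'] := sol i _ _ (fun k j => phi i (P k j)) (fun k => psi i (a k)).
  move=> c' hc'.
  have [s [c [invs hc]]] := common_denominator (locR i) (c' : 'I_m -> (R' i)^o).
  have {}hc k : phi i s * c' k = phi i (c k) := hc k.
  have [j|u [invu hu]] := common_annihilator (locR i)
      (x := fun j => \sum_k c k * P k j : R^o).
    rewrite rmorph_sum; under eq_bigr do rewrite rmorphM -hc -mulrA.
    by rewrite -mulr_sumr hc' mulr0.
  apply: (invertedI (invertedM invs invu)); rewrite scaler0 scaler_sumr.
  transitivity (psi i (\sum_k (u * c k) *: a k)).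
    rewrite (localizes_sum (loc i)); apply: eq_bigr => k _.
    rewrite (localizesZ (loc i)) !scalerA !rmorphM -hc; congr (_ *: _); ring.
  rewrite comp ?(localizes0 (loc i))// => j; rewrite -[RHS](hu j).
  by rewrite -[RHS]/(_ * _) mulr_sumr; apply: eq_bigr => k _; rewrite mulrA.
have [s [x [invs hx]]] := common_denominator (loc i) x'.
have [k|u [invu hu]] := common_annihilator (loc i)
    (x := fun k => s *: a k - \sum_j P k j *: x j).
  rewrite (localizesD (loc i)) -scaleN1r !(localizesZ (loc i)) rmorphN1.
  rewrite (localizes_sum (loc i)) -hx' scaleN1r scaler_sumr -sumrB big1// => j _.
  by rewrite (localizesZ (loc i)) -hx !scalerA mulrC subrr.
exists (u * s); last exact: invertedM.
exists (fun j => u *: x j) => k; have /eqP := hu k.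
rewrite scalerBr subr_eq0 scalerA => /eqP ->.
by rewrite scaler_sumr; apply: eq_bigr => j _; rewrite !scalerA mulrC.
Qed.

(** * Sections over a basic open subset of a spectrum *)

Section Spectrum.
Variable A : comPzRingType.

Lemma ideal_sum (J : set A) (I : Type) (s : seq I) (c b : I -> A) :
  ideal J -> (forall i, J (b i)) -> J (\sum_(i <- s) c i * b i).
Proof.
move=> [J0 JD JM] Jb; elim/big_rec: _ => // i x _ Jx.
by apply: JD => //; apply: JM.
Qed.

Lemma specX (p : spec A) (f : A) n : ~ prime_set p f -> ~ prime_set p (f ^+ n).
Proof.
move=> hf; elim: n => [|n IH]; first exact: spec1.
by rewrite exprS; exact: specM.
Qed.

(** Krull: an ideal maximal among those that contain J and no power of f is
    prime. *)
Lemma prime_avoiding (J : set A) (f : A) :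
  ideal J -> (forall n, ~ J (f ^+ n)) ->
  exists p : spec A, J `<=` prime_set p /\ ~ prime_set p f.
Proof.
move=> iJ Jf; have [J0 JD JM] := iJ.
(* the union with J makes the empty chain harmless *)
pose ok (X : set A) := ideal (X `|` J) /\ forall n, ~ (X `|` J) (f ^+ n).
have [F okF chain|B [[iB Bf] Bmax]] := @Zorn_bigcup A ok.
  split; last first.
    by move=> n [[X FX Xf]|]; [case: (okF _ FX) => _ /(_ n); apply; left|exact: Jf].
  split; first by right.
  - move=> a b [[X FX Xa]|Ja] [[Y FY Yb]|Jb].
    + wlog XY : X Y a b FX FY Xa Yb / X `<=` Y.
        move=> h; have [|] := chain X Y FX FY; first by move=> XY; exact: (h X Y).
        by move=> YX; rewrite addrC; exact: (h Y X).
      have [[_ D _] _] := okF _ FY.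
      have [||h|h] := D a b; [by left; exact: XY|by left|by left; exists Y|by right].
    + have [[_ D _] _] := okF _ FX.
      by have [||h|h] := D a b; [left|right|left; exists X|right].
    + have [[_ D _] _] := okF _ FY.
      by have [||h|h] := D a b; [right|left|left; exists Y|right].
    + by right; exact: JD.
  - move=> a b [[X FX Xb]|Jb]; last by right; exact: JM.
    have [[_ _ H] _] := okF _ FX.
    by have [|h|h] := H a b; [left|left; exists X|right].
pose I := B `|` J; have [I0 ID IM] := iB.
have grow a : ~ I a -> exists n i r, I i /\ f ^+ n = i + r * a.
  move=> Ia; apply: contrapT => no.
  pose B' := [set x | exists i r, I i /\ x = i + r * a].
  have IB' : I `<=` B' by move=> x Ix; exists x, 0; rewrite mul0r addr0.
  have B'J : B' `|` J = B'.
    by apply/seteqP; split=> [x [//|Jx]|x B'x]; [apply: IB'; right|left].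
  apply: (Bmax B').
    split=> [x Bx|sub]; first by apply: IB'; left.
    apply: Ia; left; apply: sub; exists 0, 1.
    by rewrite mul1r add0r.
  split; rewrite B'J; last by move=> n [i [r [Ii e]]]; apply: no; exists n, i, r.
  split=> [|_ _ [i [r [Ii ->]]] [j [t [Ij ->]]]|b _ [i [r [Ii ->]]]].
  - exact: IB'.
  - by exists (i + j), (r + t); split; [exact: ID|rewrite mulrDl addrACA].
  - by exists (b * i), (b * r); split; [exact: IM|rewrite mulrDr mulrA].
have pI : prime_ideal I.
  split=> //; first by rewrite -(expr0 f); exact: Bf.
  move=> a b Iab; apply: contrapT => /not_orP[/grow[n [i [r [Ii e]]]]].
  move=> /grow[k [j [t [Ij e']]]]; apply: (Bf (n + k)%N).
  rewrite exprD e e' -/I.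
  have -> : (i + r * a) * (j + t * b) =
      (j + t * b) * i + (r * a * j + r * t * (a * b)) by ring.
  by apply: (ID); [exact: IM|apply: (ID); exact: IM].
exists (Spec pI); split=> [x Jx|/= If]; first by right.
by apply: (Bf 1%N); rewrite expr1.
Qed.

Lemma radical_mem (J : set A) (f : A) : ideal J ->
  (forall p : spec A, J `<=` prime_set p -> prime_set p f) -> exists n, J (f ^+ n).
Proof.
move=> iJ hJ; apply: contrapT => /forallNP/(prime_avoiding iJ)[p [Jp]]; apply.
exact: hJ.
Qed.

Lemma spec_Ml (p : spec A) a b : ~ prime_set p (a * b) -> ~ prime_set p a.
Proof.
by case: (spec_prime p) => -[_ _ H] _ _ hab pa; apply: hab; rewrite mulrC; exact: H.
Qed.

Lemma spec_Mr (p : spec A) a b : ~ prime_set p (a * b) -> ~ prime_set p b.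
Proof. by rewrite mulrC; exact: spec_Ml. Qed.

Section Module.
Variable M : lmodType A.

Lemma frac_local_zero (m : M) (f : A) :
  (forall q : spec A, ~ prime_set q f -> frac m (@spec1 A q) = 0) ->
  exists n, f ^+ n *: m = 0.
Proof.
move=> hm; apply: (@radical_mem [set a | a *: m = 0]) => [|p Jp].
  split=> [|a b /= ha hb|a b /= hb]; first exact: scale0r.
    by rewrite scalerDl ha hb addr0.
  by rewrite -scalerA hb scaler0.
apply: contrapT => /hm; rewrite -(frac0 M (@spec1 A p)) => /fracP[u [pu e]].
by apply: pu; apply: Jp; move: e; rewrite !scale1r scaler0.
Qed.

Variables (U : opens (spec A)) (f : A) (s : tilde_sec M U).
Hypothesis UE : forall q, oset U q <-> ~ prime_set q f.

Definition represents (z : A * M) : Prop :=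
  forall q (hb : ~ prime_set q z.1), exists hq : oset U q, tfun s hq = frac z.2 hb.

Lemma represents_near (p : spec A) :
  oset U p -> exists z, ~ prime_set p z.1 /\ represents z.
Proof.
move=> hp; have [V [Vp VU [m [a h]]]] := tfunP s hp.
have [E VE] : zariski_open (oset V) := openP V.
have [e pe De] : exists2 e, ~ prime_set p e & forall q, ~ prime_set q e -> oset V q.
  move: Vp; rewrite VE => /existsNP[e /not_implyP[Ee pe]]; exists e => // q qe.
  by apply: contra_not qe; apply.
exists (e * a, e *: m); split=> [|q /= hb].
  by have [ha _] := h p hp Vp; exact: specM.
have Vq := De q (spec_Ml hb); exists (VU q Vq).
have [ha ->] := h q (VU q Vq) Vq; apply: frac_eq.
by rewrite scalerA mulrC.
Qed.

Lemma represents_power z k :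
  represents z -> represents (z.1 ^+ k.+1, z.1 ^+ k *: z.2).
Proof.
move=> hz q /= hb; have hb' : ~ prime_set q z.1 by have := hb; rewrite exprS => /spec_Ml.
have [hq e] := hz q hb'; exists hq; rewrite e; apply: frac_eq.
by rewrite scalerA exprS.
Qed.

(** Finitely many fractions n_i / b_i represent the section over D(f). After
    replacing b_i and n_i by b_i^{k+1} and b_i^k n_i for large k, they satisfy
    b_j n_i = b_i n_j exactly; then f^N = sum_i c_i b_i gives the numerator
    sum_i c_i n_i of the product of f^N with the section. *)
Lemma section_fraction : exists N m,
  forall q (hq : oset U q),
    rfrac (f ^+ N) (@spec1 A q) *: tfun s hq = frac m (@spec1 A q).
Proof.
have [N [K [z [c [hz ef]]]]] : exists N (K : finType) (z : K -> A * M) (c : K -> A),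
    (forall i, represents (z i)) /\ f ^+ N = \sum_i c i * (z i).1.
  apply: (@radical_mem [set a | exists (K : finType) (z : K -> A * M) (c : K -> A),
    (forall i, represents (z i)) /\ a = \sum_i c i * (z i).1]).
    split=> [|a b [K [z [c [hz ->]]]] [L [y [d [hy ->]]]]|a b [K [z [c [hz ->]]]]].
    - by exists void, (fun=> (0, 0)), (fun=> 0); split=> [[]|]; rewrite big1// => -[].
    - exists (K + L)%type,
        (fun i => match i with inl i => z i | inr i => y i end),
        (fun i => match i with inl i => c i | inr i => d i end).
      by split=> [[i|i] //|]; rewrite big_sumType.
    - exists K, z, (fun i => a * c i); split=> //.
      by rewrite mulr_sumr; apply: eq_bigr => i _; rewrite mulrA.
  move=> p Jp; apply: contrapT => /UE/represents_near[z [pz hz]].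
  apply: pz; apply: Jp; exists unit, (fun=> z), (fun=> 1); split=> //.
  by rewrite (big_pred1 tt) ?mul1r//; case.
pose b i := (z i).1; pose n i := (z i).2.
have /choice[k hk] (ij : K * K) : exists k,
    (b ij.1 * b ij.2) ^+ k *: (b ij.2 *: n ij.1 - b ij.1 *: n ij.2) = 0.
  case: ij => i j /=; apply: frac_local_zero => q hb.
  have [hq e] := hz i q (spec_Ml hb); have [hq' e'] := hz j q (spec_Mr hb).
  rewrite -(frac0 M (@spec1 A q)).
  move: e'; rewrite (Prop_irrelevance hq' hq) e => /fracP[u [qu eu]].
  apply/fracP; exists u; split=> //.
  by rewrite !scale1r scaler0 scalerBr eu subrr.
pose kk := \max_ij k ij.
pose b' i := b i ^+ kk.+1; pose n' i := b i ^+ kk *: n i.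
have cross i j : b' j *: n' i = b' i *: n' j.
  have := hk (i, j) => /= /(congr1 (fun x => (b i * b j) ^+ (kk - k (i, j)) *: x)).
  rewrite scaler0 scalerA -exprD subnK; last exact: (leq_bigmax (i, j)).
  rewrite scalerBr => /subr0_eq; rewrite /b' /n' !scalerA => e.
  transitivity (((b i * b j) ^+ kk * b j) *: n i).
    by congr (_ *: _); rewrite exprMn exprSr; ring.
  by rewrite e; congr (_ *: _); rewrite exprMn exprSr; ring.
have hz' i : represents (b' i, n' i) by exact: represents_power (hz i).
have some_b q : ~ prime_set q f -> exists i, ~ prime_set q (b' i).
  move=> qf; apply: contrapT => /forallNP none.
  apply: (specX (n := N) qf); rewrite ef; apply: ideal_sum.
    by case: (spec_prime q).
  move=> i; apply: contrapT => qb; apply: (none i); exact: specX.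
have [N' [c' ef']] : exists N' (c' : K -> A), f ^+ N' = \sum_i c' i * b' i.
  apply: (@radical_mem [set a | exists c' : K -> A, a = \sum_i c' i * b' i]).
    split=> [|x y [d ->] [e ->]|x y [d ->]].
    - by exists (fun=> 0); rewrite big1// => i _; rewrite mul0r.
    - exists (fun i => d i + e i); rewrite -big_split.
      by apply: eq_bigr => i _; rewrite mulrDl.
    - exists (fun i => x * d i); rewrite mulr_sumr.
      by apply: eq_bigr => i _; rewrite mulrA.
  move=> p Jp; apply: contrapT => /some_b[i]; apply; apply: Jp.
  exists (fun j => (j == i)%:R).
  by rewrite (bigD1 i)//= eqxx mul1r big1 ?addr0// => j /negPf ->; rewrite mul0r.
exists N', (\sum_i c' i *: n' i) => q hq.
have [i qb] := some_b q ((UE q).1 hq).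
have [hq' /= e] := hz' i q qb.
rewrite (Prop_irrelevance hq hq') e (fracZ _ _ _ _ (specM (@spec1 A q) qb)).
apply: frac_eq; rewrite scale1r mul1r ef' scaler_suml scaler_sumr.
by apply: eq_bigr => j _; rewrite -scalerA cross [LHS]scalerA [RHS]scalerA mulrC.
Qed.

End Module.
End Spectrum.

(** * Basic open subsets of a ringed space *)

Lemma sheaf_ext (X : topologicalType) (F : presheaf X) (U : opens X) (I : Type)
    (V : I -> opens X) (hV : forall i, V i `<=` U) (s t : F U) :
  is_sheaf F -> U `<=` \bigcup_i V i ->
  (forall i, res (hV i) s = res (hV i) t) -> s = t.
Proof.
move=> sF cov st.
have [|u [_ uniq]] := sF U I V hV (fun i => res (hV i) t) cov.
  move=> i j hi hj; rewrite (res_comp _ _ (subset_trans hi (hV i))).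
  by rewrite (res_comp _ _ (subset_trans hi (hV i))).
by rewrite -(uniq t)// (uniq s).
Qed.

Lemma rres_ext (X : topologicalType) (O : ringSheaf X) (U : opens X) (I : Type)
    (V : I -> opens X) (hV : forall i, V i `<=` U) (s t : O U) :
  U `<=` \bigcup_i V i -> (forall i, rres O (hV i) s = rres O (hV i) t) -> s = t.
Proof. exact: (@sheaf_ext X (rpresheaf O) U I V hV s t (@rsheafP X O)). Qed.

Lemma mres_ext (X : topologicalType) (O : ringSheaf X) (F : modSheaf O)
    (U : opens X) (I : Type) (V : I -> opens X) (hV : forall i, V i `<=` U)
    (s t : F U) :
  U `<=` \bigcup_i V i -> (forall i, mres F (hV i) s = mres F (hV i) t) -> s = t.
Proof. exact: (@sheaf_ext X (mpresheaf F) U I V hV s t (@msheafP X O F)). Qed.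

Section GermMorphism.
Variables (X : topologicalType) (O : ringSheaf X) (x : X) (U : opens X).
Hypothesis hx : oset U x.

Lemma rgerm_nmod : nmod_morphism (rgerm (O := O) hx).
Proof.
split=> [|s t]; last exact: rgermD.
by apply: (addrI (rgerm hx 0)); rewrite -rgermD !addr0.
Qed.

Lemma rgerm_monoid : monoid_morphism (rgerm (O := O) hx).
Proof. by split=> [|s t]; [exact: rgerm1|exact: rgermM]. Qed.

HB.instance Definition _ :=
  GRing.isNmodMorphism.Build (O U) (rstalk O x) (rgerm (O := O) hx) rgerm_nmod.
HB.instance Definition _ :=
  GRing.isMonoidMorphism.Build (O U) (rstalk O x) (rgerm (O := O) hx) rgerm_monoid.

End GermMorphism.

Section BasicOpens.
Variables (X : topologicalType) (O : ringSheaf X).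

(** The locus D(f) where f is invertible; for U = Spec A and f in A, the open
    subset of the primes that do not contain f. *)
Definition basic (U : opens X) (f : O U) : set X :=
  [set x | exists hx : oset U x, inverted (rgerm hx) f].

Lemma basic_sub (U : opens X) (f : O U) : basic f `<=` U.
Proof. by move=> x []. Qed.

Lemma basicE (U : opens X) (f : O U) x (hx : oset U x) :
  basic f x <-> inverted (rgerm hx) f.
Proof.
by split=> [[hx']|h]; [rewrite (Prop_irrelevance hx' hx)|exists hx].
Qed.

Lemma basicM (U : opens X) (f g : O U) : basic (f * g) = basic f `&` basic g.
Proof.
apply/seteqP; split=> [x [hx [v]]|x [[hx hf] /(basicE _ hx) hg]].
  rewrite rmorphM /= => e; split; exists hx.
    by exists (rgerm hx g * v); rewrite mulrA.
  by exists (rgerm hx f * v); rewrite mulrCA mulrA.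
by exists hx; exact: invertedM.
Qed.

Lemma basic1 (U : opens X) : basic (1 : O U) = U.
Proof.
by apply/seteqP; split=> [|x hx]; [exact: basic_sub|exists hx; exact: inverted1].
Qed.

Lemma basicX (U : opens X) (f : O U) n : basic f `<=` basic (f ^+ n).
Proof.
elim: n => [|n IH] x hx; first by rewrite expr0 basic1; exact: basic_sub hx.
by rewrite exprS basicM; split=> //; exact: IH.
Qed.

Lemma basic_res (U V : opens X) (h : V `<=` U) (f : O U) :
  basic (rres O h f) = V `&` basic f.
Proof.
have germE x (hV : oset V x) (hU : oset U x) : rgerm hV (rres O h f) = rgerm hU f.
  exact: (@germ_res _ (rpresheaf O)).
apply/seteqP; split=> [x [hV [v]]|x [hV [hU [v]]]].
  by rewrite /= (germE _ _ (h _ hV)); split=> //; exists (h _ hV), v.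
by rewrite /= -(germE _ hV) => e; exists hV, v.
Qed.

Lemma local_inverse (U : opens X) (f : O U) x : basic f x ->
  exists (W : opens X) (h : W `<=` U), oset W x /\ exists g : O W, rres O h f * g = 1.
Proof.
move=> [hx [v]]; have [W [hW [g ->]]] := germ_ex v; rewrite -/(rgerm hW g) /= => e.
pose l := @opensIl _ U W; pose r := @opensIr _ U W.
have hI : oset (opensI U W) x by [].
have : rgerm hI (rres O l f * rres O r g) = rgerm hI 1.
  rewrite rmorphM /= rmorph1 -e; congr (_ * _).
    exact: (@germ_res _ (rpresheaf O)).
  exact: (@germ_res _ (rpresheaf O)).
move=> /germP[V [h [h' [Vx]]]]; rewrite /= rmorphM rmorph1 => e'.
exists V, (subset_trans h l); split=> //; exists (rres O h (rres O r g)).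
by rewrite -(rres_comp l h).
Qed.

Lemma basic_open (U : opens X) (f : O U) : open (basic f).
Proof.
rewrite openE => x /local_inverse[W [h [Wx [g e]]]].
apply: (@filterS _ (nbhs x) _ W); last by apply: open_nbhs_nbhs; split=> //; exact: openP.
move=> y Wy; have : basic (rres O h f * g) y by rewrite e basic1.
by rewrite basicM basic_res => -[[]].
Qed.

Definition basic_opens (U : opens X) (f : O U) : opens X := Opens (basic_open f).

Lemma basic_unit (U : opens X) (f : O U) : U `<=` basic f -> exists g, f * g = 1.
Proof.
move=> Uf; pose I := {x | oset U x}.
have /choice[W hW] (i : I) : exists W : opens X, oset W (sval i) /\
    exists (h : W `<=` U) (g : O W), rres O h f * g = 1.
  by have [W [h [Wx hg]]] := local_inverse (Uf _ (svalP i)); exists W; split=> //; exists h.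
have h i : W i `<=` U by have [_ []] := hW i.
have /all_sig[g hg] i : {g : O (W i) | rres O (h i) f * g = 1}.
  by apply: cid; have [_ [h' ?]] := hW i; rewrite (Prop_irrelevance (h i) h').
have cov : U `<=` \bigcup_i W i.
  by move=> x Ux; exists (exist _ x Ux) => //; case: (hW (exist _ x Ux)).
have [|t [ht _]] := @rsheafP X O U I W h g cov.
  move=> i j hi hj /=.
  have inv k (hk : opensI (W i) (W j) `<=` W k) :
      rres O (subset_trans hi (h i)) f * rres O hk (g k) = 1.
    by rewrite -(rres_comp (h k) hk) -rmorphM hg rmorph1.
  by rewrite -[LHS]mulr1 -(inv j hj) mulrCA mulrA (inv i hi) mul1r.
exists t; apply: (@rres_ext X O U I W h (f * t) 1 cov) => i /=.
by rewrite rmorphM -[rres O (h i) t]/(res (p := rpresheaf O) (h i) t) ht hg rmorph1.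
Qed.

(** The structure sheaf as a module over itself, so that what follows applies
    to both the functions and the sections of a sheaf of modules. *)
Definition self_sheaf : modSheaf O :=
  @ModSheaf X O (fun U => (O U)^o : lmodType (O U))
    (fun U V h => rres O h : {additive (O U)^o -> (O V)^o})
    (fun U V h a s => rmorphM (rres O h) a s)
    (@rres_id X O) (@rres_comp X O) (@rsheafP X O).

End BasicOpens.

(** For all f in O(U), the sections of F over the basic open subset of f are
    the localization of F(U) at the powers of f. *)
Record fractional (X : topologicalType) (O : ringSheaf X) (F : modSheaf O)
    (U : opens X) : Prop := Fractional {
  fractional_eq0 : forall (f : O U) (V : opens X) (h : V `<=` U) (s : F U),
    basic f `<=` V -> mres F h s = 0 -> exists n, f ^+ n *: s = 0;
  fractional_ext : forall (f : O U) (V : opens X) (h : V `<=` U) (t : F V),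
    oset V = basic f -> exists n s, mres F h s = rres O h (f ^+ n) *: t }.

Section Fractional.
Variables (X : topologicalType) (O : ringSheaf X).

Lemma mresXZ (F : modSheaf O) (U V : opens X) (h : V `<=` U) (f : O U) n (s : F U) :
  mres F h (f ^+ n *: s) = rres O h f ^+ n *: mres F h s.
Proof. by rewrite mresZ rmorphXn. Qed.

(** Inside D(g), every function a is a' / g^n, and D(a) = D(g a'). *)
Lemma fractional_basic (F : modSheaf O) (U W : opens X) (g : O U) :
  fractional (self_sheaf O) U -> fractional F U -> W `<=` U ->
  oset W = basic g -> fractional F W.
Proof.
move=> qO qF h eW; pose c := rres O h g.
have Wc : basic c = W by rewrite basic_res -eW setIid.
have [d cd] : exists d, c * d = 1 by apply: basic_unit; rewrite Wc.
have frac_fun (a : O W) : exists n a', rres O h a' = c ^+ n * a.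
  have [n [a' e]] := fractional_ext qO (f := g) h a eW.
  by exists n, a'; rewrite -rmorphXn.
have basic_frac n (a : O W) a' : rres O h a' = c ^+ n * a -> basic (g * a') = basic a.
  move=> e; rewrite basicM -eW -basic_res e basicM.
  apply/seteqP; split=> [x []//|x ax]; split=> //; apply: basicX.
  by rewrite Wc; exact: basic_sub ax.
have cancel n k a : (d ^+ n.+1) ^+ k * (c * (c ^+ n * a)) ^+ k = a ^+ k.
  by rewrite -exprMn (mulrA c) -exprS mulrA -exprMn (mulrC d) cd expr1n mul1r.
split=> [a V hV s aV s0|a V hV t eV].
  have [n [a' e]] := frac_fun a.
  have [m [s' es]] := fractional_ext qF (f := g) h s eW.
  have [||k ek] := fractional_eq0 qF (f := g * a') (h := subset_trans hV h) (s := s').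
  - by rewrite (basic_frac _ _ _ e).
  - by rewrite -(mres_comp h hV) es mresZ s0 scaler0.
  have cs0 : (c * (c ^+ n * a)) ^+ k *: (c ^+ m *: s) = 0.
    have /(congr1 (mres F h)) := ek.
    by rewrite mresXZ raddf0 es rmorphM e rmorphXn.
  have dcm : d ^+ m * c ^+ m = 1 by rewrite -exprMn mulrC cd expr1n.
  exists k; rewrite -(cancel n k a).
  transitivity ((d ^+ m * (d ^+ n.+1) ^+ k) *:
      ((c * (c ^+ n * a)) ^+ k *: (c ^+ m *: s))); last by rewrite cs0 scaler0.
  rewrite !scalerA; congr (_ *: _).
  move: (d ^+ m) (c ^+ m) ((d ^+ n.+1) ^+ k) ((c * _) ^+ k) dcm => p q u v pq.
  by transitivity ((p * q) * (u * v)); [rewrite pq mul1r|ring].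
have [n [a' e]] := frac_fun a.
have [k [s' es]] := fractional_ext qF (f := g * a') (subset_trans hV h) t
  (etrans eV (esym (basic_frac _ _ _ e))).
exists k, ((d ^+ n.+1) ^+ k *: mres F h s').
rewrite mresZ (mres_comp h hV (subset_trans hV h)) es scalerA.
have eh : rres O h ((g * a') ^+ k) = (c * (c ^+ n * a)) ^+ k.
  by rewrite rmorphXn rmorphM e.
by congr (_ *: _); rewrite -(rres_comp h hV) eh -rmorphM (cancel n k a).
Qed.

Lemma fractional_eq0_glue (F : modSheaf O) (U : opens X) (K : finType) (f : K -> O U) :
  U `<=` \bigcup_k basic (f k) -> (forall k, fractional F (basic_opens (f k))) ->
  forall (a : O U) (V : opens X) (h : V `<=` U) (s : F U),
    basic a `<=` V -> mres F h s = 0 -> exists n, a ^+ n *: s = 0.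
Proof.
move=> cov qF a V h s aV s0.
have hW k : basic_opens (f k) `<=` U := @basic_sub _ _ _ (f k).
have /choice[n hn] k : exists n, rres O (hW k) a ^+ n *: mres F (hW k) s = 0.
  pose VW := opensI (basic_opens (f k)) V.
  apply: (fractional_eq0 (qF k) (h := @opensIl _ (basic_opens (f k)) V : VW `<=` _)).
    by rewrite basic_res => x [Wx /aV].
  rewrite (mres_comp _ _ (subset_trans (@opensIr _ _ _) h)).
  by rewrite -(mres_comp h (@opensIr _ _ _)) s0 raddf0.
exists (\max_k n k).
apply: (@mres_ext X O F U K (fun k => basic_opens (f k)) hW) => [x Ux|k].
  by have [k _ ?] := cov x Ux; exists k.
rewrite /= mresXZ raddf0 -(subnK (leq_bigmax k)) exprD -scalerA hn.
exact: scaler0.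
Qed.

(** Extend a^N t to each of the finitely many pieces, with N common to all. The
    differences on overlaps vanish where a is invertible, hence are killed by a
    power of a; after multiplication by it the extensions can be glued. *)
Lemma fractional_glue (F : modSheaf O) (U : opens X) (K : finType) (f : K -> O U) :
  fractional (self_sheaf O) U -> U `<=` \bigcup_k basic (f k) ->
  (forall k, fractional F (basic_opens (f k))) -> fractional F U.
Proof.
move=> qO cov qF; split; first exact: fractional_eq0_glue cov qF.
move=> a V h t eV; pose W k := basic_opens (f k).
have hW k : W k `<=` U := @basic_sub _ _ _ (f k).
pose VW k := opensI (W k) V.
have hVW k : VW k `<=` W k := @opensIl _ (W k) V.
have hVV k : VW k `<=` V := @opensIr _ (W k) V.
have /choice[n hn] k : exists n (s : F (W k)),
    mres F (hVW k) s = rres O (hVW k) (rres O (hW k) a ^+ n) *: mres F (hVV k) t.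
  by apply: (fractional_ext (qF k)); rewrite basic_res -eV.
have /all_sig[s hs] k := cid (hn k).
pose N := \max_k n k.
pose s1 k := rres O (hW k) a ^+ (N - n k) *: s k.
have hs1 k : mres F (hVW k) (s1 k) =
    rres O (subset_trans (hVV k) h) a ^+ N *: mres F (hVV k) t.
  rewrite mresXZ hs scalerA rmorphXn -exprD subnK ?leq_bigmax//.
  by rewrite (rres_comp _ _ (subset_trans (hVV k) h)).
pose WW (ij : K * K) := opensI (W ij.1) (W ij.2).
have hl ij : WW ij `<=` W ij.1 := @opensIl _ (W ij.1) (W ij.2).
have hr ij : WW ij `<=` W ij.2 := @opensIr _ (W ij.1) (W ij.2).
have hWU ij : WW ij `<=` U := subset_trans (hl ij) (hW ij.1).
have qWW ij : fractional F (WW ij).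
  have qOW : fractional (self_sheaf O) (W ij.1).
    exact: (fractional_basic (g := f ij.1) qO qO (hW ij.1)).
  apply: (fractional_basic (g := rres O (hW ij.1) (f ij.2)) qOW (qF ij.1) (hl ij)).
  by rewrite basic_res.
have /choice[m hm] ij : exists m,
    rres O (hWU ij) a ^+ m *: (mres F (hl ij) (s1 ij.1) - mres F (hr ij) (s1 ij.2)) = 0.
  pose V' := opensI (WW ij) V.
  have hV' : V' `<=` WW ij := @opensIl _ (WW ij) V.
  apply: (fractional_eq0 (qWW ij) (h := hV')).
    by rewrite basic_res -eV.
  have V'1 : V' `<=` VW ij.1 by move=> x [[]].
  have V'2 : V' `<=` VW ij.2 by move=> x [[]].
  have V'U : V' `<=` U := subset_trans hV' (hWU ij).
  have V'V : V' `<=` V := @opensIr _ (WW ij) V.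
  rewrite raddfB /= (mres_comp _ _ (subset_trans V'1 (hVW _))).
  rewrite (mres_comp _ _ (subset_trans V'2 (hVW _))).
  rewrite -(mres_comp (hVW _) V'1) -(mres_comp (hVW _) V'2) !hs1 !mresXZ.
  rewrite !(rres_comp _ _ V'U) !(mres_comp _ _ V'V) subrr //.
pose M := \max_ij m ij.
pose s2 k := rres O (hW k) a ^+ M *: s1 k.
have cov' : U `<=` \bigcup_k W k by [].
have [|u [hu _]] := @msheafP X O F U K W hW s2 cov'.
  move=> i j hi hj /=; apply: subr0_eq; rewrite (mresXZ hi _ M) (mresXZ hj _ M).
  rewrite !(rres_comp _ _ (hWU (i, j))) -scalerBr.
  have := hm (i, j); rewrite /= (Prop_irrelevance (hl (i, j)) hi).
  rewrite (Prop_irrelevance (hr (i, j)) hj) => hij.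
  have mM : (m (i, j) <= M)%N by exact: leq_bigmax.
  by rewrite -(subnK mM) exprD -scalerA hij scaler0.
exists (M + N)%N, u.
apply: (@mres_ext X O F V K VW hVV) => [x Vx|k].
  by have [k _ ?] := cov x (h x Vx); exists k.
rewrite /= (mres_comp _ _ (subset_trans (hVW k) (hW k))).
have uE : mres F (hW k) u = s2 k := hu k.
rewrite -(mres_comp (hW k) (hVW k)) uE (mresXZ (hVW k) _ M) hs1 mresZ scalerA.
rewrite !(rres_comp _ _ (subset_trans (hVV k) h)).
by rewrite -exprD rmorphXn.
Qed.

End Fractional.

(** * Consequences of affineness *)

Section AffineLike.
Variables (X : topologicalType) (O : ringSheaf X).

(** What the rest of the proof uses of the fact that U is the spectrum of O(U). *)
Record affine_like (U : opens X) : Prop := AffineLike {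
  basic_basis : forall (x : X) (W : opens X), oset U x -> oset W x ->
    exists f : O U, basic f x /\ basic f `<=` W;
  unit_ideal : forall J : set (O U), ideal J ->
    (forall x, oset U x -> exists2 f, J f & basic f x) -> J 1;
  basicD : forall f g : O U, basic (f + g) `<=` basic f `|` basic g;
  basic0 : basic (0 : O U) = set0;
  fractional_self : fractional (self_sheaf O) U }.

(** The functions whose basic open subset is covered by finitely many good
    ones form an ideal. *)
Lemma basic_compact (U : opens X) (good : O U -> Prop) : affine_like U ->
  (forall x, oset U x -> exists2 f, good f & basic f x) ->
  exists (K : finType) (f : K -> O U),
    (forall k, good (f k)) /\ U `<=` \bigcup_k basic (f k).
Proof.
move=> aU cov; pose J : set (O U) := [set a | exists (K : finType) (f : K -> O U),
  (forall k, good (f k)) /\ basic a `<=` \bigcup_k basic (f k)].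
suff [K [f [gf]]] : J 1 by rewrite basic1; exists K, f.
apply: (unit_ideal aU) => [|x Ux]; last first.
  have [f gf fx] := cov x Ux; exists f => //.
  by exists unit, (fun=> f); split=> // y fy; exists tt.
split=> [|a b [K [f [gf af]]] [L [g [gg bg]]]|a b [K [f [gf bf]]]].
- by exists void, (fun=> 0); split=> [[]|]; rewrite (basic0 aU).
- exists (K + L)%type, (fun i => match i with inl k => f k | inr l => g l end).
  split=> [[k|l] //|x /(basicD aU)[/af|/bg] [i _ ?]]; first by exists (inl i).
  by exists (inr i).
- by exists K, f; split=> //; rewrite basicM => x [_ /bf].
Qed.

(** Shrink to D(f) in U, then inside it to D(g) in V. The restriction of g to
    D(f) is g' / f^n for some g' in O(U), so that D(g) = D(f g'). *)
Lemma common_basic (U V : opens X) x : affine_like U -> affine_like V ->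
  oset U x -> oset V x ->
  exists (f : O U) (g : O V), basic f x /\ basic f = basic g.
Proof.
move=> aU aV Ux Vx; have [f [fx fV']] := basic_basis aU Ux Vx.
have fV : basic_opens f `<=` V := fV'.
have [g [gx gf]] := basic_basis aV Vx (fx : oset (basic_opens f) x).
have hU : basic_opens f `<=` U := @basic_sub _ _ _ f.
have [n [g' e]] := fractional_ext (fractional_self aU) (f := f) hU
  (rres O fV g) erefl.
have {}e : rres O hU g' = rres O hU (f ^+ n) * rres O fV g := e.
suff fg : basic (f * g') = basic g by exists (f * g'), g; split=> //; rewrite fg.
rewrite basicM -[basic f]/(oset (basic_opens f)) -basic_res e basicM !basic_res.
apply/seteqP; split=> [y [_ []] //|y gy]; have fy := gf y gy.
by split; split=> //; exact: basicX.
Qed.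

(** Quasi-coherence on a neighbourhood of each point suffices, because basic
    open subsets of U that are also basic in such a neighbourhood cover U. *)
Lemma fractional_affine (F : modSheaf O) (U : opens X) : affine_like U ->
  (forall x, oset U x -> exists V : opens X,
     [/\ oset V x, affine_like V & fractional F V]) ->
  fractional F U.
Proof.
move=> aU loc.
have [|K [f [gf cov]]] :=
  @basic_compact U (fun f => fractional F (basic_opens f)) aU.
  move=> x Ux; have [V [Vx aV qV]] := loc x Ux.
  have [f [g [fx fg]]] := common_basic aU aV Ux Vx; exists f => //.
  apply: (fractional_basic (g := g) (fractional_self aV) qV) => //.
  by move=> y; rewrite /= fg => /basic_sub.
exact: (fractional_glue (fractional_self aU) cov gf).
Qed.

Section Stalk.
Variables (U : opens X) (x : X) (hx : oset U x).
Hypothesis aU : affine_like U.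

Lemma section_as_fraction (F : modSheaf O) (W : opens X) (t : F W) :
  fractional F U -> oset W x ->
  exists (f : O U) (s : F U) (V : opens X) (h : V `<=` U) (h' : V `<=` W),
    [/\ inverted (rgerm hx) f, oset V x & mres F h s = rres O h f *: mres F h' t].
Proof.
move=> qF Wx; have [f [fx fW']] := basic_basis aU hx Wx.
have fW : basic_opens f `<=` W := fW'.
have hU : basic_opens f `<=` U := @basic_sub _ _ _ f.
have [n [s e]] := fractional_ext qF (f := f) hU (mres F fW t) erefl.
exists (f ^+ n), s, (basic_opens f), hU, fW; split=> //.
by apply/basicE; exact: basicX.
Qed.

Lemma section_vanishing (F : modSheaf O) (W : opens X) (h : W `<=` U) (s : F U) :
  fractional F U -> oset W x -> mres F h s = 0 ->
  exists f, inverted (rgerm hx) f /\ f *: s = 0.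
Proof.
move=> qF Wx s0; have [f [fx fW]] := basic_basis aU hx Wx.
have [n e] := fractional_eq0 qF fW s0.
by exists (f ^+ n); split=> //; apply/basicE; exact: basicX.
Qed.

Lemma mgerm0 (F : modSheaf O) (W : opens X) (hW : oset W x) :
  mgerm (F := F) hW 0 = 0.
Proof. by apply: (addrI (mgerm hW 0)); rewrite -mgermD !addr0. Qed.

Lemma localizes_stalk (F : modSheaf O) : fractional F U ->
  localizes (rgerm hx) (mgerm (F := F) hx).
Proof.
move=> qF; split=> [s t|a s|z|s].
- exact: mgermD.
- exact: mgermZ.
- have [W [Wx [t ->]]] := germ_ex z; rewrite -/(mgerm Wx t).
  have [f [s [V [h [h' [finv Vx e]]]]]] := section_as_fraction t qF Wx.
  exists f, s; split=> //.
  transitivity (mgerm Vx (rres O h f *: mres F h' t)).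
    rewrite mgermZ; congr (_ *: _); apply: esym.
      exact: (@germ_res _ (rpresheaf O)).
    exact: (@germ_res _ (mpresheaf F)).
  by rewrite -e; exact: (@germ_res _ (mpresheaf F)).
- rewrite -(mgerm0 F hx) => /germP[W [h [h' [Wx]]]] /=.
  rewrite raddf0; exact: section_vanishing.
Qed.

Lemma localizes_stalk_ring :
  localizes (rgerm hx) (rgerm hx : (O U)^o -> (rstalk O x)^o).
Proof.
have qO := fractional_self aU; split=> [s t|a s|z|s].
- exact: rgermD.
- exact: rgermM.
- have [W [Wx [t ->]]] := germ_ex (z : stalk (rpresheaf O) x).
  have [f [s [V [h [h' [finv Vx e]]]]]] :=
    section_as_fraction (F := self_sheaf O) t qO Wx.
  exists f, s; split=> //.
  transitivity (rgerm Vx (rres O h f * rres O h' t)).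
    rewrite rgermM; congr (_ * _); apply: esym; exact: (@germ_res _ (rpresheaf O)).
  have {}e : rres O h s = rres O h f * rres O h' t := e.
  by rewrite -e; exact: (@germ_res _ (rpresheaf O)).
- move=> s0; have : rgerm hx s = rgerm hx 0 by rewrite s0 rmorph0.
  move=> /germP[W [h [h' [Wx]]]] /=.
  rewrite rmorph0; exact: (section_vanishing (F := self_sheaf O)).
Qed.

End Stalk.
End AffineLike.

(** * Affine charts *)

Section Constant.
Variables (A : comPzRingType) (M : lmodType A).

Lemma constant_sectionP (W : opens (spec A)) (m : M) :
  locally_fraction (fun p (_ : oset W p) => frac m (@spec1 A p)).
Proof.
move=> p hp; exists W; split=> //; exists m, 1 => q _ _.
by exists (@spec1 A q).
Qed.

Definition constant_section (W : opens (spec A)) (m : M) : tilde_sec M W :=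
  TildeSec (constant_sectionP m).

Lemma constant_section0 (W : opens (spec A)) : constant_section W 0 = 0.
Proof. by apply: tilde_ext => p hp; exact: frac0. Qed.

Lemma constant_sectionD (W : opens (spec A)) (m n : M) :
  constant_section W (m + n) = constant_section W m + constant_section W n.
Proof.
apply: tilde_ext => p hp /=.
rewrite (fracD _ _ _ _ (specM (@spec1 A p) (@spec1 A p))).
by apply: frac_eq; rewrite !scale1r mulr1 scale1r.
Qed.

Lemma global_section (W : opens (spec A)) (s : tilde_sec M W) :
  (forall p, oset W p) -> exists m, s = constant_section W m.
Proof.
move=> WT; have [|N [m h]] := @section_fraction A M W 1 s.
  by move=> q; split=> // _; exact: spec1.
exists m; apply: tilde_ext => p hp /=; rewrite -h expr1n.
exact: esym (scale1r _).
Qed.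

End Constant.

Lemma constant_sectionZ (A : comPzRingType) (M : lmodType A)
    (W : opens (spec A)) (a : A) (m : M) :
  constant_section W (a *: m) =
  (constant_section W (a : A^o) : spec_sec W) *: constant_section W m.
Proof.
apply: tilde_ext => p hp /=.
rewrite -/(rfrac a (@spec1 A p)) (fracZ _ _ _ _ (specM (@spec1 A p) (@spec1 A p))).
by apply: frac_eq; rewrite mulr1.
Qed.

Section Chart.
Variables (X : topologicalType) (O : ringSheaf X) (U : opens X).
Variables (A : comPzRingType) (c : affine_chart O U A).

Let pre (V : opens X) := opens_preimage (chart_continuous c) V.
Let UU : U `<=` U := @subset_refl _ U.

Lemma chartP x : oset U x -> exists p, chart c p = x.
Proof. by rewrite -(chart_range c) => -[p _]; exists p. Qed.

Lemma chart_in p : oset (pre U) p.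
Proof. by rewrite /= -(chart_range c); exists p. Qed.

Lemma chart_ring_inj (V : opens X) (h : V `<=` U) : injective (chart_ring c h).
Proof. exact: bij_inj (chart_ring_bij c h). Qed.

Lemma function_of_ex (a : A) : exists f : O U,
  chart_ring c UU f = constant_section (pre U) (a : A^o).
Proof.
have [g _ gK] := chart_ring_bij c UU.
by exists (g (constant_section (pre U) (a : A^o))); rewrite gK.
Qed.

(** The isomorphism of A with O(U). *)
Definition function_of (a : A) : O U := projT1 (cid (function_of_ex a)).

Lemma function_ofE (a : A) :
  chart_ring c UU (function_of a) = constant_section (pre U) (a : A^o).
Proof. exact: projT2 (cid (function_of_ex a)). Qed.

Lemma function_of_surj (f : O U) : exists a, f = function_of a.
Proof.
have [a e] := global_section (chart_ring c UU f : tilde_sec A^o (pre U)) chart_in.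
by exists a; apply: (@chart_ring_inj _ UU); rewrite function_ofE.
Qed.

Lemma function_of0 : function_of 0 = 0.
Proof.
apply: (@chart_ring_inj _ UU); rewrite function_ofE rmorph0.
exact: constant_section0.
Qed.

Lemma function_of1 : function_of 1 = 1.
Proof.
apply: (@chart_ring_inj _ UU); rewrite function_ofE rmorph1.
exact: tilde_ext.
Qed.

Lemma function_ofD a b : function_of (a + b) = function_of a + function_of b.
Proof.
apply: (@chart_ring_inj _ UU); rewrite rmorphD !function_ofE.
exact: constant_sectionD.
Qed.

Lemma function_ofM a b : function_of (a * b) = function_of a * function_of b.
Proof.
apply: (@chart_ring_inj _ UU); rewrite rmorphM !function_ofE.
exact: (@constant_sectionZ A A^o).
Qed.

Lemma function_ofX a n : function_of (a ^+ n) = function_of a ^+ n.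
Proof.
elim: n => [|n IH]; first exact: function_of1.
by rewrite !exprS function_ofM IH.
Qed.

Lemma chart_res (V : opens X) (h : V `<=` U) (a : A) :
  chart_ring c h (rres O h (function_of a)) = constant_section (pre V) (a : A^o).
Proof.
by rewrite (chart_ring_res c UU h h) function_ofE; exact: tilde_ext.
Qed.

Lemma basic_avoids (a : A) p : basic (function_of a) (chart c p) -> ~ prime_set p a.
Proof.
move=> /local_inverse[W [h [Wp [g e]]]] pa.
have := congr1 (chart_ring c h) e.
rewrite rmorphM rmorph1 chart_res => /(congr1 (fun s : tilde_sec A^o (pre W) => tfun s Wp)).
have [n [b [hb eb]]] := frac_ex (tfun (chart_ring c h g : tilde_sec A^o (pre W)) Wp).
rewrite /= eb -/(rfrac a (@spec1 A p)).
rewrite (fracZ _ _ _ _ (specM (@spec1 A p) hb)) => /fracP[u [hu]].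
rewrite -![_ *: _]/(_ * _) mul1r mulr1 mul1r => eu.
have := specM hu hb; rewrite -eu; apply.
have [[_ _ H] _ _] := spec_prime p.
by rewrite mulrCA mulrC; apply: H.
Qed.

Lemma avoids_basic (a : A) p : ~ prime_set p a -> basic (function_of a) (chart c p).
Proof.
move=> pa; pose D := [set q : spec A | ~ prime_set q a].
have oD : open D.
  exists [set a]; apply/seteqP; split=> q /= qa; first by move/(_ a erefl).
  by move=> h; apply: qa => _ ->.
pose V : opens X := Opens (chart_open c oD).
have VU : V `<=` U by move=> _ [q _ <-]; exact: chart_in.
have VD q : oset (pre V) q -> ~ prime_set q a.
  by move=> [r Dr /(@chart_inj _ _ _ _ c) <-].
have sP : @locally_fraction A A^o (pre V) (fun q hq => frac (1 : A^o) (VD q hq)).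
  by move=> q hq; exists (pre V); split=> //; exists 1, a => r hr _; exists (VD r hr).
have [k _ kK] := chart_ring_bij c VU.
have Vp : oset V (chart c p) by exists p.
have e : rres O VU (function_of a) * k (TildeSec sP) = 1.
  apply: (@chart_ring_inj _ VU); rewrite rmorphM rmorph1 chart_res kK.
  apply: tilde_ext => q hq /=; rewrite -/(rfrac a (@spec1 A q)).
  rewrite (fracZ _ _ _ _ (specM (@spec1 A q) (VD q hq))); apply: frac_eq.
  by rewrite -![_ *: _]/(_ * _); ring.
have : basic (rres O VU (function_of a) * k (TildeSec sP)) (chart c p).
  by rewrite e basic1.
by rewrite basicM basic_res => -[[]].
Qed.

Lemma fractional_tilde (F : modSheaf O) (M : lmodType A) :
  tilde_chart F c M -> fractional F U.
Proof.
move=> m; have inj (V : opens X) (h : V `<=` U) := bij_inj (chart_mod_bij m h).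
split=> [f V h s fV s0|f V h t eV]; have [a ea] := function_of_surj f.
  have [y ey] := global_section (chart_mod m UU s : tilde_sec M (pre U)) chart_in.
  have [q qa|n en] := @frac_local_zero A M y a.
    have Vq : oset (pre V) q by apply: fV; rewrite ea; exact: avoids_basic.
    have := chart_mod_res m UU h h s; rewrite s0 raddf0 ey.
    by move=> /(congr1 (fun z : tilde_sec M (pre V) => tfun z Vq)) /= <-.
  exists n; apply: (inj _ UU); rewrite raddf0 chart_modZ ea -function_ofX.
  rewrite function_ofE ey -constant_sectionZ en.
  exact: constant_section0.
have VE q : oset (pre V) q <-> ~ prime_set q a.
  rewrite /= eV ea; split; [exact: basic_avoids|exact: avoids_basic].
have [N [y ey]] := section_fraction (chart_mod m h t : tilde_sec M (pre V)) VE.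
have [k _ kK] := chart_mod_bij m UU.
exists N, (k (constant_section (pre U) y)); apply: (inj _ h).
rewrite (chart_mod_res m UU) kK chart_modZ ea -function_ofX chart_res.
by apply: tilde_ext => q hq /=; rewrite -ey.
Qed.

Lemma affine_like_chart : affine_like O U.
Proof.
split.
- move=> x W /chartP[p <-] Wp.
  have [E WE] : zariski_open (oset (pre W)) := openP (pre W).
  have : oset (pre W) p := Wp.
  rewrite WE => /existsNP[a /not_implyP[Ea pa]]; exists (function_of a).
  split=> [|y ay]; first exact: avoids_basic.
  have [q qy] := chartP (basic_sub ay); move: ay; rewrite -qy => /basic_avoids qa.
  suff : oset (pre W) q by [].
  by rewrite WE => /(_ a Ea).
- move=> J [J0 JD JM] cov.
  have [||n] := @radical_mem A [set a | J (function_of a)] 1.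
  + split=> [|a b /= Ja Jb|a b /= Jb]; first by rewrite /= function_of0.
      by rewrite function_ofD; exact: JD.
    by rewrite function_ofM; exact: JM.
  + move=> p Jp; exfalso.
    have [f Jf fp] := cov _ (chart_in p : oset U (chart c p)).
    have [a ea] := function_of_surj f; rewrite ea in Jf fp.
    exact: basic_avoids fp (Jp _ Jf).
  + by rewrite /= expr1n function_of1.
- move=> f g x fgx; have [p ep] := chartP (basic_sub fgx); move: fgx; rewrite -ep.
  have [a ->] := function_of_surj f; have [b ->] := function_of_surj g.
  rewrite -function_ofD => /basic_avoids pab.
  apply: contrapT => /not_orP[fp gp]; apply: pab.
  have [[_ D _] _ _] := spec_prime p.
  by apply: D; apply: contrapT => /avoids_basic.
- apply/seteqP; split=> // x x0; have [p ep] := chartP (basic_sub x0).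
  move: x0; rewrite -ep -function_of0 => /basic_avoids; apply.
  by have [[]] := spec_prime p.
- apply: (@fractional_tilde _ A^o).
  exact: (@TildeChart X O (self_sheaf O) U A c A^o
    (fun V h => chart_ring c h)
    (fun V h a s => rmorphM (chart_ring c h) a s)
    (chart_ring_bij c) (chart_ring_res c)).
Qed.

End Chart.

(** * Absolutely pure quasi-coherent sheaves *)

Section QuasiCoherent.
Variables (X : scheme) (F : modSheaf (structure_sheaf X)).
Hypothesis hF : quasi_coherent F.

Lemma affine_open_like (U : opens X) :
  affine_open (structure_sheaf X) U -> affine_like (structure_sheaf X) U.
Proof. by move=> [A [c]]; exact: (affine_like_chart c). Qed.

Lemma fractional_quasi_coherent (U : opens X) :
  affine_open (structure_sheaf X) U -> fractional F U.
Proof.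
move=> aU; apply: fractional_affine (affine_open_like aU) _ => x _.
have [V [A [c [M [Vx [m]]]]]] := hF x; exists V; split=> //.
  exact: (affine_like_chart c).
exact: fractional_tilde m.
Qed.

Lemma absolutely_pure_stalk (U : opens X) (x : X) : locally_coherent X ->
  affine_open (structure_sheaf X) U -> oset U x ->
  absolutely_pure (F U) -> absolutely_pure (mstalk F x).
Proof.
move=> hX aU Ux /absolutely_pureP pU; apply/absolutely_pureP.
have lU := affine_open_like aU.
apply: (solves_systems_localization (localizes_stalk_ring Ux lU)
  (localizes_stalk Ux lU (fractional_quasi_coherent aU)) _ pU).
by move=> m n P; apply: coherent_finite_kernel; exact: hX.
Qed.

Lemma absolutely_pure_sections (U : opens X) : affine_open (structure_sheaf X) U ->
  (forall x, oset U x -> absolutely_pure (mstalk F x)) -> absolutely_pure (F U).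
Proof.
move=> aU pS; apply/absolutely_pureP; have lU := affine_open_like aU.
apply: (@solves_systems_local _ (F U) {x | oset U x}
  (fun i => rstalk (structure_sheaf X) (sval i)) (fun i => mstalk F (sval i))
  (fun i => rgerm (svalP i)) (fun i => mgerm (F := F) (svalP i))).
- by move=> i; exact: localizes_stalk_ring.
- by move=> i; apply: localizes_stalk => //; exact: fractional_quasi_coherent.
- move=> J iJ cov; apply: (unit_ideal lU) => // x Ux.
  have [f Jf fx] := cov (exist _ x Ux); exists f => //.
  exact: (ex_intro _ (svalP (exist _ x Ux)) fx).
- by move=> i; apply/absolutely_pureP; apply: pS; exact: svalP.
Qed.

End QuasiCoherent.

Theorem proposition5p7 (X : scheme) (F : modSheaf (structure_sheaf X))
    (hX : locally_coherent X) (hF : quasi_coherent F) :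
  let O := structure_sheaf X in
  let cond1 := forall U : opens X, affine_open O U -> absolutely_pure (F U) in
  let cond2 := exists (I : Type) (U : I -> opens X),
      [/\ forall i : I, affine_open O (U i),
          \bigcup_i oset (U i) = setT
        & forall i : I, absolutely_pure (F (U i))] in
  let cond3 := forall x : X, absolutely_pure (mstalk F x) in
  (cond1 <-> cond2) /\ (cond2 <-> cond3).
Proof.
move=> O cond1 cond2 cond3.
have c12 : cond1 -> cond2.
  move=> h; have /choice[U hU] := @scheme_affine X.
  exists X, U; split=> [x||x].
  - by case: (hU x).
  - by apply/seteqP; split=> // x _; exists x => //; case: (hU x).
  - by apply: h; case: (hU x).
have c23 : cond2 -> cond3.
  move=> [I [U [aU cov pU]]] x.
  have [i _ Ux] : (\bigcup_i oset (U i)) x by rewrite cov.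
  exact: (absolutely_pure_stalk hF hX (aU i) Ux (pU i)).
have c31 : cond3 -> cond1.
  by move=> h U aU; apply: absolutely_pure_sections => // x _; exact: h.
by split; split=> // h; [apply: c31; exact: c23|apply: c12; exact: c31].
Qed.
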